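(* Let $d\in\mathbb{N}$ and $s>0$. Then $$\lim_{n\to\infty}\frac{n^s\,a_n(I_d:H^{s,*}_{\rm mix}(\mathbb{T}^d)\to L_2(\mathbb{T}^d))}{(\ln n)^{(d-1)s}}=\Big[\frac{2^d}{(d-1)!}\Big]^s .$$
   Context: $\mathbb{N}=\{1,2,3,\dots\}$. $\mathbb{T}^d$ is the $d$-torus, represented by $[0,2\pi]^d$ with opposite sides identified. $L_2(\mathbb{T}^d)$ carries the norm $\|f|L_2(\mathbb{T}^d)\|=(\int_{\mathbb{T}^d}|f(x)|^2dx)^{1/2}$, and for $f\in L_2(\mathbb{T}^d)$ the Fourier coefficients are $c_k(f)=(2\pi)^{-d/2}\int_{\mathbb{T}^d}f(x)e^{-ikx}dx$, $k\in\mathbb{Z}^d$ (so $\|f|L_2(\mathbb{T}^d)\|^2=\sum_k|c_k(f)|^2$). For $s>0$, $H^{s,*}_{\rm mix}(\mathbb{T}^d)$ is the space of all $f\in L_2(\mathbb{T}^d)$ for which the norm $$\|f|H^s_{\rm mix}(\mathbb{T}^d)\|^{*}=\Big[\sum_{k\in\mathbb{Z}^d}|c_k(f)|^2\prod_{j=1}^d(1+|k_j|^{2s})\Big]^{1/2}$$ is finite, equipped with this norm. $I_d$ denotes the identical embedding $f\mapsto f$. The approximation numbers of a bounded linear operator $T:X\to Y$ between Banach spaces are $a_n(T:X\to Y)=\inf\{\|T-A:X\to Y\| : A:X\to Y \text{ bounded linear},\ {\rm rank}\,A<n\}$, $n\in\mathbb{N}$. *)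

(* Defs.v *)
From HB Require Import structures.
From mathcomp Require Import all_boot all_order all_algebra.
From mathcomp Require Import all_classical all_reals all_analysis.
From mathcomp Require Import measurable_realfun complex ring.

Set Implicit Arguments.
Unset Strict Implicit.
Unset Printing Implicit Defensive.

Import Order.TTheory GRing.Theory Num.Theory.
Import numFieldNormedType.Exports.

Local Open Scope classical_set_scope.
Local Open Scope complex_scope.
Local Open Scope ring_scope.

Local Notation Re := (@complex.Re _).
Local Notation Im := (@complex.Im _).
Local Notation normc := (@Normc.normc _).

(* The normed spaces X and Y are given as vector spaces with explicit norm
   functions nX and nY valued in R, the scalar field K being R[i] below. *)
Section ApproximationNumbers.
Variables (R : realType) (K : fieldType) (X Y : lmodType K).
Variables (nX : X -> R) (nY : Y -> R).

Definition bounded_op (B : X -> Y) : Prop :=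
  exists M : R, forall x, nY (B x) <= M * nX x.

Definition op_norm (B : X -> Y) : R :=
  sup [set nY (B x) | x in [set x | nX x <= 1]].

(* rank A = m: the range of A has a basis with m elements. *)
Definition has_rank (A : X -> Y) (m : nat) : Prop :=
  exists b : 'I_m -> Y,
    [/\ forall i, exists x, A x = b i,
        forall a : 'I_m -> K, \sum_i a i *: b i = 0 -> forall i, a i = 0
      & forall x, exists a : 'I_m -> K, A x = \sum_i a i *: b i].

Definition rank_lt (A : X -> Y) (n : nat) : Prop :=
  exists2 m, (m < n)%N & has_rank A m.

(* Only meaningful for 0 < n: when n = 0 no A has rank < n, and inf set0 = 0. *)
Definition approx_number (T : {linear X -> Y}) (n : nat) : R :=
  inf [set r | exists A : {linear X -> Y},
    [/\ bounded_op A, rank_lt A n & r = op_norm (fun x => T x - A x)]].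

End ApproximationNumbers.

Section ComplexIntegral.
Context d (T : measurableType d) (R : realType).
Variable mu : {measure set T -> \bar R}.
Implicit Types f g : T -> R[i].

Definition cintegral f : R[i] :=
  (\int[mu]_x Re (f x)) +i* (\int[mu]_x Im (f x)).

Definition cintegrable f : Prop :=
  mu.-integrable setT (EFin \o (Re \o f)) /\
  mu.-integrable setT (EFin \o (Im \o f)).

Lemma cintegralP (a : R[i]) f g : cintegrable f -> cintegrable g ->
  cintegral (a *: f + g) = a * cintegral f + cintegral g.
Proof.
move=> [f1 f2] [g1 g2]; case: a => a b.
have E1 : (EFin \o (Re \o ((a +i* b) *: f + g))) =
  (fun x => (a%:E * (Re (f x))%:E - b%:E * (Im (f x))%:E)
    + (Re (g x))%:E)%E.
  apply/funext => x /=.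
  rewrite -!EFinM -EFinB -EFinD; congr (_%:E).
  by rewrite /GRing.add/= /GRing.scale/=; case: (f x) (g x) => [? ?] [? ?].
have E2 : (EFin \o (Im \o ((a +i* b) *: f + g))) =
  (fun x => (a%:E * (Im (f x))%:E + b%:E * (Re (f x))%:E)
    + (Im (g x))%:E)%E.
  apply/funext => x /=.
  rewrite -!EFinM -!EFinD; congr (_%:E).
  by rewrite /GRing.add/= /GRing.scale/=; case: (f x) (g x) => [? ?] [? ?].
rewrite /cintegral /Rintegral.
rewrite [X in fine X +i* _](_ : _ = a%:E * (\int[mu]_x (Re (f x))%:E)
   - b%:E * (\int[mu]_x (Im (f x))%:E) + \int[mu]_x (Re (g x))%:E)%E;
  last first.
  transitivity (integral mu setT (EFin \o (Re \o ((a +i* b) *: f + g)))) => //.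
  rewrite E1 integralD//; last by apply: integrableB => //; exact: integrableZl.
  by rewrite integralB// ?integralZl//; exact: integrableZl.
rewrite [X in _ +i* fine X](_ : _ = a%:E * (\int[mu]_x (Im (f x))%:E)
   + b%:E * (\int[mu]_x (Re (f x))%:E) + \int[mu]_x (Im (g x))%:E)%E;
  last first.
  transitivity (integral mu setT (EFin \o (Im \o ((a +i* b) *: f + g)))) => //.
  rewrite E2 integralD//; last by apply: integrableD => //; exact: integrableZl.
  by rewrite integralD// ?integralZl//; exact: integrableZl.
have := integrable_fin_num measurableT f1.
have := integrable_fin_num measurableT f2.
have := integrable_fin_num measurableT g1.
have := integrable_fin_num measurableT g2.
rewrite /=.
move=> /fineK <- /fineK <- /fineK <- /fineK <-.
by rewrite -!EFinM -EFinB -!EFinD.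
Qed.

End ComplexIntegral.

Section L2.
Context d (T : measurableType d) (R : realType).
Variable mu : {finite_measure set T -> \bar R}.
Implicit Types f g : T -> R[i].

Definition cmeasurable f : Prop :=
  measurable_fun setT (Re \o f) /\ measurable_fun setT (Im \o f).

Definition cL2norm f : \bar R := 'N[mu]_2[EFin \o (normc \o f)]%E.

Definition L2_pred : {pred T -> R[i]} :=
  fun f => `[< cmeasurable f /\ (cL2norm f < +oo)%E >].

Lemma cmeasurable_normc f : cmeasurable f ->
  measurable_fun setT (normc \o f).
Proof.
move=> [mr mi].
have -> : normc \o f =
    (fun x => Num.sqrt (((Re \o f) x) ^+ 2 + ((Im \o f) x) ^+ 2)).
  by apply/funext => x /=; case: (f x).
apply: (@measurableT_comp _ _ _ _ _ _ (@Num.sqrt R)).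
  by apply: continuous_measurable_fun; exact: sqrt_continuous.
by apply: measurable_funD; exact: measurable_funX.
Qed.

Lemma cmeasurable_lin (a : R[i]) f g : cmeasurable f -> cmeasurable g ->
  cmeasurable (a *: f + g).
Proof.
case: a => a b [f1 f2] [g1 g2]; split.
  have -> : Re \o ((a +i* b) *: f + g) =
      (fun x => (a * (Re \o f) x - b * (Im \o f) x) + (Re \o g) x).
    apply/funext => x /=.
    by rewrite /GRing.add/= /GRing.scale/=; case: (f x) (g x) => [? ?] [? ?].
  apply: measurable_funD => //; apply: measurable_funB;
    by apply: measurable_funM.
have -> : Im \o ((a +i* b) *: f + g) =
    (fun x => (a * (Im \o f) x + b * (Re \o f) x) + (Im \o g) x).
  apply/funext => x /=.
  by rewrite /GRing.add/= /GRing.scale/=; case: (f x) (g x) => [? ?] [? ?].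
apply: measurable_funD => //; apply: measurable_funD;
  by apply: measurable_funM.
Qed.

Lemma L2_predP f : reflect (cmeasurable f /\ (cL2norm f < +oo)%E) (f \in L2_pred).
Proof. exact: asboolP. Qed.

Lemma normc_Lfun f : f \in L2_pred -> (normc \o f) \in Lfun mu 2%:E.
Proof.
move=> /L2_predP[mf nf]; rewrite inE; apply/andP; split; rewrite inE/=.
  exact: cmeasurable_normc.
exact: nf.
Qed.

Lemma Lnorm2_le (u v : T -> R) :
  measurable_fun setT u -> measurable_fun setT v ->
  (forall x, 0 <= u x <= v x) ->
  ('N[mu]_2[EFin \o u] <= 'N[mu]_2[EFin \o v])%E.
Proof.
move=> mu_ mv uv; rewrite unlock.
have mp (w : T -> R) : measurable_fun setT w ->
    measurable_fun setT (fun x : T => `|(EFin \o w) x| `^ 2)%E.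
  move=> mw.
  rewrite (_ : (fun x => _) = EFin \o (fun x => `|w x| `^ 2)%R)//.
  apply/measurable_EFinP.
  apply: (@measurableT_comp _ _ _ _ _ _ (fun x : R => x `^ 2)%R) => //.
  exact: measurableT_comp.
rewrite gt0_ler_poweR//.
- by rewrite in_itv/= leey integral_ge0// => x _; exact: poweR_ge0.
- by rewrite in_itv/= leey integral_ge0// => x _; exact: poweR_ge0.
- apply: ge0_le_integral => //.
  + by move=> x _; exact: poweR_ge0.
  + exact: mp.
  + exact: mp.
  + move=> x _; have /andP[u0 uvx] := uv x.
    rewrite /= lee_fin ge0_ler_powR// ?nnegrE//.
    by rewrite !ger0_norm// (le_trans u0).
Qed.

Lemma L2_submod_closed : submod_closed L2_pred.
Proof.
split.
  apply/L2_predP; split; first by split; exact: measurable_cst.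
  rewrite /cL2norm.
  have -> : EFin \o (normc \o (0 : T -> R[i])) = cst 0%E.
    apply/funext => x; congr (_%:E); exact: Normc.normc0.
  by rewrite Lnorm0// eqe.
move=> a f g fP gP; apply/L2_predP.
have /L2_predP[mf _] := fP; have /L2_predP[mg _] := gP.
split; first exact: cmeasurable_lin.
have h : (normc a \o* (normc \o f) \+ (normc \o g))%R
    \in Lfun mu 2%:E.
  have := Lfun_submod_closed mu (lee1n 2) => -[_ /(_ (normc a))].
  move=> /(_ _ _ (normc_Lfun fP) (normc_Lfun gP)).
  rewrite (_ : _ *: _ + _ = (normc a \o* (normc \o f) \+ (normc \o g))%R)//.
  by apply/funext => x; rewrite /GRing.add/= /GRing.scale/= mulrC.
move: h; rewrite inE => /andP[_]; rewrite inE/=; apply: le_lt_trans.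
apply: Lnorm2_le.
- by apply: cmeasurable_normc; exact: cmeasurable_lin.
- apply: measurable_funD; last exact: cmeasurable_normc.
  by apply: measurable_funM => //; exact: cmeasurable_normc.
- move=> x /=; apply/andP; split; first by case: ((_ : T -> R[i]) x) => ? ? /=; exact: sqrtr_ge0.
  rewrite mulrC -Normc.normcM; exact: (le_normcD (a * f x) (g x)).
Qed.

HB.instance Definition _ := GRing.isSubmodClosed.Build _ _ L2_pred
  L2_submod_closed.

Record L2fun := MkL2fun { L2fun_val :> T -> R[i] ; _ : L2fun_val \in L2_pred }.

HB.instance Definition _ := [isSub for L2fun_val].
HB.instance Definition _ := [Choice of L2fun by <:].
HB.instance Definition _ := [SubChoice_isSubLmodule of L2fun by <:].

Definition L2null : {pred L2fun} :=
  fun f : L2fun => `[< {ae mu, forall x, f x = 0} >].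

Lemma L2nullP (f : L2fun) : reflect {ae mu, forall x, f x = 0} (f \in L2null).
Proof. exact: asboolP. Qed.

Lemma L2null_submod_closed : submod_closed L2null.
Proof.
split; first by apply/L2nullP/aeW.
move=> a f g /L2nullP f0 /L2nullP g0; apply/L2nullP.
apply: filterS2 f0 g0 => x f0 g0.
by rewrite -[LHS]/(a * f x + g x) f0 g0 mulr0 addr0.
Qed.

HB.instance Definition _ := GRing.isSubmodClosed.Build _ _ L2null
  L2null_submod_closed.

(* Square-integrable functions modulo equality almost everywhere. *)
Definition L2 : Type := Quotient.quot L2null.

HB.instance Definition _ := Choice.on L2.
HB.instance Definition _ := GRing.Zmodule.on L2.
HB.instance Definition _ := EqQuotient.on L2.
HB.instance Definition _ := ZmodQuotient.on L2.

Local Open Scope quotient_scope.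

Definition L2scale (a : R[i]) : L2 -> L2 := lift_op1 L2 ( *:%R a).

Lemma pi_L2scale a : {morph \pi_L2 : f / a *: f >-> L2scale a f}.
Proof.
move=> f; unlock L2scale; apply/eqP.
rewrite piE /= Quotient.equivE -scalerBr rpredZ//.
by rewrite Quotient.idealrBE reprK.
Qed.
Canonical pi_L2scale_morph a := PiMorph1 (pi_L2scale a).

Lemma L2scaleA a b (f : L2) : L2scale a (L2scale b f) = L2scale (a * b) f.
Proof. by rewrite -[f]reprK !piE scalerA. Qed.

Lemma L2scale1 : left_id 1 L2scale.
Proof. by move=> f; rewrite -[f]reprK !piE scale1r. Qed.

Lemma L2scaleDr : right_distributive L2scale +%R.
Proof. by move=> a f g; rewrite -[f]reprK -[g]reprK !piE scalerDr. Qed.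

Lemma L2scaleDl (f : L2) : {morph L2scale^~ f : a b / a + b}.
Proof. by move=> a b; rewrite -[f]reprK !piE scalerDl. Qed.

HB.instance Definition _ := GRing.Zmodule_isLmodule.Build R[i] L2
  L2scaleA L2scale1 L2scaleDr L2scaleDl.

(* Independent of the representative, see repr_piP. *)
Definition L2norm (f : L2) : R := fine (cL2norm (repr f)).

Lemma repr_piP (f : L2fun) : {ae mu, forall x, (repr (\pi_L2 f)) x = f x}.
Proof.
have : repr (\pi_L2 f) - f \in L2null by rewrite Quotient.idealrBE reprK.
move=> /L2nullP; apply: filterS => x.
by move=> /eqP; rewrite [X in X == _]/(repr (\pi_L2 f) x - f x) subr_eq0 => /eqP.
Qed.
End L2.

Section ConsMeasure.
Context d (T : measurableType d) (R : realType) (n : nat).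
Variable m1 : {finite_measure set T -> \bar R}.
Variable m2 : {finite_measure set (n.-tuple T) -> \bar R}.

Definition cons_tuple (p : T * n.-tuple T) : n.+1.-tuple T :=
  [tuple of p.1 :: p.2].

Lemma measurable_cons_tuple : measurable_fun setT cons_tuple.
Proof. exact: measurable_cons. Qed.

Definition cons_measure : set (n.+1.-tuple T) -> \bar R :=
  pushforward (m1 \x m2)%E cons_tuple.

Let cons_measure_meas : {measure set (n.+1.-tuple T) -> \bar R} :=
  measure_function_pushforward__canonical__measure_function_Measure
    (m1 \x m2)%E measurable_cons_tuple.

HB.instance Definition _ := Measure.copy cons_measure cons_measure_meas.

Let cons_measure_fin : fin_num_fun cons_measure.
Proof.
move=> A mA; rewrite ge0_fin_numE//.
apply: (@le_lt_trans _ _ (cons_measure setT)).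
  by apply: le_measure; rewrite ?inE.
rewrite /cons_measure /pushforward preimage_setT -setXTT product_measure1E//.
by rewrite lte_mul_pinfty// ?fin_num_measure// ltey_eq fin_num_measure.
Qed.

HB.instance Definition _ := Measure_isFinite.Build _ _ _ cons_measure
  cons_measure_fin.

End ConsMeasure.

(* The n-fold product measure of m, carried by n-tuples. *)
Fixpoint power_measure d (T : measurableType d) (R : realType)
    (m : {finite_measure set T -> \bar R}) (n : nat) :
    {finite_measure set (n.-tuple T) -> \bar R} :=
  match n with
  | 0 => \d_([tuple] : 0.-tuple T)
  | n'.+1 => cons_measure m (power_measure m n')
  end.

Section Torus.
Variable R : realType.

Local Notation period := `[0%R, (2 * pi)%R].

Lemma lebesgue_period_lty : (@lebesgue_measure R [set` period] < +oo)%E.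
Proof. by rewrite lebesgue_measure_itv/=; case: ifP => _; rewrite ltey. Qed.

(* Lebesgue measure restricted to [0, 2 pi] (total mass 2 pi, not normalized).
   Points outside the period form a null set, hence are invisible in L2; so is
   the identification of the endpoints. *)
Definition circle_measure : {finite_measure set (measurableTypeR R) -> \bar R} :=
  @mfrestr _ (measurableTypeR R) R _ lebesgue_measure (measurable_itv period)
    lebesgue_period_lty.

Variable d : nat.

Definition torus : Type := d.-tuple (measurableTypeR R).

HB.instance Definition _ := Measurable.on torus.

Definition torus_measure : {finite_measure set torus -> \bar R} :=
  power_measure circle_measure d.

End Torus.

Section FourierCoefficients.
Variables (R : realType) (d : nat).
Local Notation T := (torus R d).
Local Notation mu := (torus_measure R d).
Implicit Types (f g : T -> R[i]) (k : d.-tuple int).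

Definition expi (t : R) : R[i] := cos t +i* sin t.

Definition phase k (x : T) : R := \sum_(j < d) (tnth k j)%:~R * tnth x j.

Definition fourier_coef f k : R[i] :=
  ((2 * pi) `^ (- (d%:R / 2)))%:C
  * cintegral mu (fun x => f x * expi (- phase k x)).

Lemma measurable_phase k : measurable_fun setT (phase k).
Proof.
apply: measurable_sum => j; apply: measurable_funM => //.
exact: measurable_tnth.
Qed.

Lemma L2_cintegrableM f (u : T -> R) : f \in L2_pred mu ->
  measurable_fun setT u -> cintegrable mu (fun x => f x * expi (u x)).
Proof.
move=> fL mu_; have /L2_predP[[fr fi] _] := fL.
have intn : mu.-integrable setT (EFin \o (normc \o f)).
  apply/Lfun1_integrable; apply: Lfun_subset12 (normc_Lfun fL).
  exact: fin_num_measure.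
have ir : mu.-integrable setT (EFin \o (Re \o f)).
  apply: le_integrable intn => //; first exact/measurable_EFinP.
  move=> x _; rewrite /= lee_fin; case: (f x) => a b /=.
  by rewrite -sqrtr_sqr ger0_norm ?sqrtr_ge0// ler_sqrt ?addr_ge0 ?sqr_ge0// lerDl sqr_ge0.
have ii : mu.-integrable setT (EFin \o (Im \o f)).
  apply: le_integrable intn => //; first exact/measurable_EFinP.
  move=> x _; rewrite /= lee_fin; case: (f x) => a b /=.
  by rewrite -sqrtr_sqr ger0_norm ?sqrtr_ge0// ler_sqrt ?addr_ge0 ?sqr_ge0// lerDr sqr_ge0.
have mc : measurable_fun setT (cos \o u).
  by apply: measurableT_comp => //; apply: continuous_measurable_fun; exact: continuous_cos.
have ms : measurable_fun setT (sin \o u).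
  by apply: measurableT_comp => //; apply: continuous_measurable_fun; exact: continuous_sin.
have bc : [bounded (cos \o u) x | x in [set: T]].
  by exists 1; split => // M M1 x _ /=; rewrite (le_trans _ (ltW M1))// ler_norml cos_geN1 cos_le1.
have bs : [bounded (sin \o u) x | x in [set: T]].
  by exists 1; split => // M M1 x _ /=; rewrite (le_trans _ (ltW M1))// ler_norml sin_geN1 sin_le1.
split.
  have -> : EFin \o (Re \o (fun x => f x * expi (u x))) =
    (((EFin \o (Re \o f)) \* (EFin \o (cos \o u))) \-
     ((EFin \o (Im \o f)) \* (EFin \o (sin \o u))))%E.
    by apply/funext => x /=; rewrite -!EFinM -EFinB; case: (f x).
  by apply: integrableB => //; apply: integrableMl.
have -> : EFin \o (Im \o (fun x => f x * expi (u x))) =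
  (((EFin \o (Re \o f)) \* (EFin \o (sin \o u))) \+
   ((EFin \o (Im \o f)) \* (EFin \o (cos \o u))))%E.
  by apply/funext => x /=; rewrite -!EFinM -EFinD; case: (f x).
by apply: integrableD => //; apply: integrableMl.
Qed.

Lemma fourier_coef_lin a f g k : f \in L2_pred mu -> g \in L2_pred mu ->
  fourier_coef (a *: f + g) k = a * fourier_coef f k + fourier_coef g k.
Proof.
move=> fL gL; rewrite /fourier_coef.
have mk : measurable_fun setT (fun x : T => - phase k x).
  by apply: measurableT_comp => //; exact: measurable_phase.
have -> : (fun x => (a *: f + g) x * expi (- phase k x)) =
    a *: (fun x => f x * expi (- phase k x)) + (fun x => g x * expi (- phase k x)).
  apply/funext => x.
  by rewrite -[LHS]/((a * f x + g x) * _) -[RHS]/(a * (f x * _) + g x * _) mulrDl mulrA.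
rewrite cintegralP; [|exact: L2_cintegrableM..].
by rewrite mulrDr mulrCA.
Qed.

Lemma ae_eq_fourier_coef f g k : f \in L2_pred mu -> g \in L2_pred mu ->
  {ae mu, forall x, f x = g x} -> fourier_coef f k = fourier_coef g k.
Proof.
move=> fL gL fg; rewrite /fourier_coef; congr (_ * _).
have mk : measurable_fun setT (fun x : T => - phase k x).
  by apply: measurableT_comp => //; exact: measurable_phase.
have [fr fi] := L2_cintegrableM fL mk.
have [gr gi] := L2_cintegrableM gL mk.
rewrite /cintegral /Rintegral; congr (fine _ +i* fine _).
  apply: ae_eq_integral => //; [exact: measurable_int fr|exact: measurable_int gr|].
  by apply: filterS fg => x /= -> _.
apply: ae_eq_integral => //; [exact: measurable_int fi|exact: measurable_int gi|].
by apply: filterS fg => x /= -> _.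
Qed.

End FourierCoefficients.

Section MixedSobolev.
Variables (R : realType) (d : nat) (s : R).
Local Notation T := (torus R d).
Local Notation mu := (torus_measure R d).

Definition L2torus : Type := L2 mu.
HB.instance Definition _ := GRing.Lmodule.on L2torus.

Implicit Types (f g : L2torus) (k : d.-tuple int).

Definition L2coef f k : R[i] := fourier_coef (repr f) k.

Lemma L2coef_lin a f g k :
  L2coef (a *: f + g) k = a * L2coef f k + L2coef g k.
Proof.
rewrite /L2coef -fourier_coef_lin; [|exact: valP..].
apply: ae_eq_fourier_coef; first exact: valP.
  by have := valP (a *: repr f + repr g); apply.
have := repr_piP (a *: repr f + repr g : L2fun mu).
by rewrite -[X in repr X](_ : a *: f + g = _)// -[f in LHS]reprK -[g in LHS]reprK !piE.
Qed.

Definition mix_weight k : R :=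
  \prod_(j < d) (1 + (`|tnth k j|%:~R : R) `^ (2 * s)).

Definition mix_sum f : \bar R :=
  \esum_(k in [set: d.-tuple int]) (normc (L2coef f k) ^+ 2 * mix_weight k)%:E.

Definition Hmix_pred : {pred L2torus} := fun f => (mix_sum f < +oo)%E.

Lemma mix_weight_ge0 k : 0 <= mix_weight k.
Proof. by apply: prodr_ge0 => j _; rewrite addr_ge0// powR_ge0. Qed.

Lemma normc_ge0 (z : R[i]) : 0 <= normc z.
Proof. by case: z => a b; exact: sqrtr_ge0. Qed.

Lemma esum_le_scale (c : R) (u : d.-tuple int -> R) : 0 <= c ->
  (forall k, 0 <= u k) ->
  (\esum_(k in [set: d.-tuple int]) (c * u k)%:E <=
   c%:E * \esum_(k in [set: d.-tuple int]) (u k)%:E)%E.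
Proof.
move=> c0 u0; apply: ge_ereal_sup => _ [X XT <-].
have [finX _] := XT.
rewrite fsbig_finite//= sumEFin -mulr_sumr EFinM lee_wpmul2l ?lee_fin//.
apply: esum_ge; exists X => //.
by rewrite fsbig_finite//= sumEFin.
Qed.

Lemma Hmix_submod_closed : submod_closed Hmix_pred.
Proof.
have H0 f k : (0 <= (normc (L2coef f k) ^+ 2 * mix_weight k)%:E)%E.
  by rewrite lee_fin mulr_ge0 ?sqr_ge0// mix_weight_ge0.
split.
  have c0 k : L2coef 0 k = 0.
    by have := L2coef_lin (-1) 0 0 k; rewrite scaler0 addr0 mulN1r addNr.
  rewrite unfold_in /mix_sum esum1// => k _.
  by rewrite c0 Normc.normc0 expr0n mul0r.
move=> a f g fP gP; rewrite unfold_in.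
set A : R := 2 * normc a ^+ 2.
have A0 : 0 <= A by rewrite mulr_ge0// sqr_ge0.
apply: (@le_lt_trans _ _ (A%:E * mix_sum f + 2%:E * mix_sum g)%E).
  have u0 h k : 0 <= normc (L2coef h k) ^+ 2 * mix_weight k.
    by rewrite mulr_ge0 ?sqr_ge0// mix_weight_ge0.
  apply: (@le_trans _ _
    (\esum_(k in [set: d.-tuple int])
       (A * (normc (L2coef f k) ^+ 2 * mix_weight k))%:E
     + \esum_(k in [set: d.-tuple int])
       (2 * (normc (L2coef g k) ^+ 2 * mix_weight k))%:E)%E).
    rewrite -esumD; [|by move=> k _; rewrite lee_fin mulr_ge0..].
    apply: le_esum => k _; rewrite -EFinD lee_fin !mulrA -mulrDl.
    apply: ler_wpM2r; first exact: mix_weight_ge0.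
    have := le_normcD (a * L2coef f k) (L2coef g k).
    rewrite -L2coef_lin (Normc.normcM a (L2coef f k)) /A => h.
    have := normc_ge0 (L2coef (a *: f + g) k).
    move: h; set w := normc (L2coef (a *: f + g) k).
    move: (normc a) (normc (L2coef f k)) (normc (L2coef g k)) => x y z h w0.
    apply: (@le_trans _ _ ((x * y + z) ^+ 2)).
      by rewrite lerXn2r ?nnegrE// (le_trans w0 h).
    rewrite -subr_ge0 [leRHS](_ : _ = (x * y - z) ^+ 2) ?sqr_ge0//.
    by ring.
  by apply: leeD; apply: esum_le_scale.
by rewrite lte_add_pinfty// lte_mul_pinfty.
Qed.

HB.instance Definition _ := GRing.isSubmodClosed.Build _ _ Hmix_pred
  Hmix_submod_closed.

Record Hmix := MkHmix { Hmix_val :> L2torus ; _ : Hmix_val \in Hmix_pred }.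

HB.instance Definition _ := [isSub for Hmix_val].
HB.instance Definition _ := [Choice of Hmix by <:].
HB.instance Definition _ := [SubChoice_isSubLmodule of Hmix by <:].

Definition Hmix_norm (f : Hmix) : R := Num.sqrt (fine (mix_sum f)).

Definition Hmix_embedding : {linear Hmix -> L2torus} := \val.
End MixedSobolev.

(* Main.v *)
(** The numbers [a_n] are the inverse square roots of the weights
    [w_k = prod_j (1 + |k_j|^(2s))] in increasing order.  Projecting onto the
    modes of small weight gives the upper bound, by Parseval.  For the lower
    bound, an operator of rank less than [n] vanishes at some nonzero
    trigonometric polynomial built from any [n] given modes.

    It remains to count frequencies.  Since [w_k] is at least
    [prod_j max(1, |k_j|)^(2s)], and at most [t^-d] times that number once all
    [|k_j|] are large ([t < 1]), everything reduces to the hyperbolic crosses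
    [prod_j max(1, |k_j|) <= r], possibly with a cutoff [|k_j| >= M].  Slicing
    along one coordinate turns their cardinality into the sums
    [sum_m (X - ln m)^p / m], which telescope against [(X - ln m)^(p+1)] up to
    lower order terms; the cardinality is thus
    [2^d r (ln r)^(d-1) / (d-1)!] asymptotically.

    Parseval's identity on the torus comes from density of trigonometric
    polynomials: the sets whose indicator lies in their L2 closure form a
    sigma-algebra, which contains the half spaces [x_j < a] because these are,
    up to null sets, the sets [cos(x_j - a/2) > cos(a/2)]. *)
Require Import Defs.
From HB Require Import structures.
From mathcomp Require Import all_boot all_order all_algebra.
From mathcomp Require Import all_classical all_reals all_analysis.
From mathcomp Require Import measurable_realfun complex.
From mathcomp Require Import zify ring lra.

Set Implicit Arguments.
Unset Strict Implicit.
Unset Printing Implicit Defensive.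

Import Order.TTheory GRing.Theory Num.Theory.
Import numFieldNormedType.Exports.

Local Open Scope classical_set_scope.
Local Open Scope ring_scope.

(** * Closure of an algebra of bounded functions in L2 *)

Section SquareNorm.
Context {R : realType}.
Implicit Types z w : R[i].

(** The obstacle in the lower bound is the factor prod_j (1 + |k_j|^(-2s)) between the weight and
    its multiplicative model: it equals 2 per coordinate at |k_j| = 1 and would spoil the constant.
    The cutoff M removes such frequencies. This costs only lower order terms, since confining one
    coordinate to finitely many values leaves crosses of one dimension less, with one logarithm
    less. So the leading constant does not depend on M, and t may tend to 1 after n tends to
    infinity.

    In the counting, lower order terms would pile up under induction on the dimension. They are
    stored as a shift c inside the logarithm, (ln r + c)^p above and (ln r - c)^p below, a shape
    that slicing reproduces with a larger c.

    The count is inverted by hand: n is about C r (ln r)^(d-1) with ln r asymptotic to ln n, which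
    suggests r = n / (C (ln n)^(d-1)). A factor t^(-d) on this radius leaves room: d - 1 powers of t
    pay for replacing ln r by ln n, one for the additive errors. *)

Definition sqn z : R := complex.Re z ^+ 2 + complex.Im z ^+ 2.

Lemma sqn_normc z : Normc.normc z ^+ 2 = sqn z.
Proof. by case: z => a b /=; rewrite sqr_sqrtr// addr_ge0// sqr_ge0. Qed.

Lemma sqn_ge0 z : 0 <= sqn z.
Proof. by rewrite addr_ge0// sqr_ge0. Qed.

Lemma sqnM z w : sqn (z * w) = sqn z * sqn w.
Proof. by case: z w => [a b] [c e]; rewrite /sqn /=; ring. Qed.

Lemma sqnN z : sqn (- z) = sqn z.
Proof. by case: z => [a b]; rewrite /sqn /= !sqrrN. Qed.

Lemma sqn_real (a : R) : sqn a%:C%C = a ^+ 2.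
Proof. by rewrite /sqn /= expr0n addr0. Qed.

Lemma sqn0 : sqn 0 = 0.
Proof. by rewrite /sqn /= expr0n addr0. Qed.

(** The difference of the two sides is [sqn (z - w)]. With its factor 2, this stands in for the
    triangle inequality and avoids square roots. *)
Lemma sqnD_le z w : sqn (z + w) <= 2 * sqn z + 2 * sqn w.
Proof.
case: z w => [a b] [c e]; rewrite /sqn /=.
rewrite -subr_ge0 [leRHS](_ : _ = (a - c) ^+ 2 + (b - e) ^+ 2); last by ring.
by rewrite addr_ge0// sqr_ge0.
Qed.

Lemma sqn_eq0 z : sqn z = 0 -> z = 0.
Proof.
case: z => a b; rewrite /sqn /= => /eqP.
by rewrite paddr_eq0 ?sqr_ge0// !sqrf_eq0 => /andP[/eqP -> /eqP ->].
Qed.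
End SquareNorm.

Section Closure.
Context d (T : measurableType d) (R : realType).
Variable mu : {finite_measure set T -> \bar R}.
Implicit Types f g h : T -> R[i].

Definition L2sq f : \bar R := (\int[mu]_x (sqn (f x))%:E)%E.
Arguments L2sq f%_R.

Lemma measurable_sqn f : cmeasurable f -> measurable_fun setT (sqn \o f).
Proof. by move=> [mr mi]; apply: measurable_funD; exact: measurable_funX. Qed.

Lemma cmeasurableD f g : cmeasurable f -> cmeasurable g ->
  cmeasurable (f \+ g).
Proof.
move=> mf mg; rewrite (_ : f \+ g = 1 *: f + g); first exact: cmeasurable_lin.
by apply/funext => x; rewrite scale1r.
Qed.

Lemma cmeasurableM f g : cmeasurable f -> cmeasurable g ->
  cmeasurable (f \* g).
Proof.
move=> [f1 f2] [g1 g2]; split.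
  rewrite (_ : _ \o _ = fun x =>
    complex.Re (f x) * complex.Re (g x) - complex.Im (f x) * complex.Im (g x)).
    by apply: measurable_funB; exact: measurable_funM.
  by apply/funext => x /=; case: (f x) (g x) => [? ?] [? ?].
rewrite (_ : _ \o _ = fun x =>
  complex.Re (f x) * complex.Im (g x) + complex.Im (f x) * complex.Re (g x)).
  by apply: measurable_funD; exact: measurable_funM.
by apply/funext => x /=; case: (f x) (g x) => [? ?] [? ?].
Qed.

Lemma cmeasurable_cst (c : R[i]) : cmeasurable (fun _ : T => c).
Proof. by split; exact: measurable_cst. Qed.

Lemma cmeasurableN f : cmeasurable f -> cmeasurable (\- f).
Proof.
move=> mf; rewrite (_ : (\- f) = (fun _ => -1) \* f).
  by apply: cmeasurableM => //; exact: cmeasurable_cst.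
by apply/funext => x /=; rewrite mulN1r.
Qed.

Lemma cmeasurableB f g : cmeasurable f -> cmeasurable g ->
  cmeasurable (f \- g).
Proof. by move=> mf mg; apply: cmeasurableD => //; exact: cmeasurableN. Qed.

Lemma cmeasurable_real (u : T -> R) : measurable_fun setT u ->
  cmeasurable (fun x => (u x)%:C%C).
Proof. by move=> mu_; split => //; exact: measurable_cst. Qed.

Lemma L2sq_ge0 f : (0 <= L2sq f)%E.
Proof. by apply: integral_ge0 => x _; rewrite lee_fin sqn_ge0. Qed.

(** Integrates a pointwise bound once and for all: sums ([L2sqD]) and products with a bounded factor
    ([L2sqM_le]) are both instances. *)
Lemma L2sq_le_lin f g h (a b : R) : 0 <= a -> 0 <= b ->
  cmeasurable f -> cmeasurable g -> cmeasurable h ->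
  (forall x, sqn (f x) <= a * sqn (g x) + b * sqn (h x)) ->
  (L2sq f <= a%:E * L2sq g + b%:E * L2sq h)%E.
Proof.
move=> a0 b0 mf mg mh fgh.
have m (k : T -> R[i]) : cmeasurable k -> measurable_fun setT (fun x => (sqn (k x))%:E).
  by move=> mk; apply/measurable_EFinP; exact: measurable_sqn.
rewrite /L2sq -!ge0_integralZl//; try exact: m;
  try by (move=> x _; rewrite lee_fin sqn_ge0).
rewrite -ge0_integralD//; first last.
- by apply: measurable_funeM; exact: m.
- by move=> x _; rewrite mule_ge0// lee_fin// sqn_ge0.
- by apply: measurable_funeM; exact: m.
- by move=> x _; rewrite mule_ge0// lee_fin// sqn_ge0.
apply: ge0_le_integral => //.
- by move=> x _; rewrite lee_fin sqn_ge0.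
- exact: m.
- by apply: emeasurable_funD; apply: measurable_funeM; exact: m.
- by move=> x _; rewrite -!EFinM -EFinD lee_fin.
Qed.

Lemma ae_eq_L2sq f g : cmeasurable f -> cmeasurable g ->
  {ae mu, forall x, f x = g x} -> L2sq f = L2sq g.
Proof.
move=> mf mg fg; apply: ge0_ae_eq_integral => //.
- by apply/measurable_EFinP; exact: measurable_sqn.
- by apply/measurable_EFinP; exact: measurable_sqn.
- by move=> x _; rewrite lee_fin sqn_ge0.
- by move=> x _; rewrite lee_fin sqn_ge0.
- by apply: filterS fg => x -> _.
Qed.

Lemma L2sqD f g : cmeasurable f -> cmeasurable g ->
  (L2sq (f \+ g) <= 2%:E * L2sq f + 2%:E * L2sq g)%E.
Proof.
move=> mf mg; apply: L2sq_le_lin => //; first exact: cmeasurableD.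
by move=> x; exact: sqnD_le.
Qed.

Lemma L2sqM_le (K : R) f g : 0 <= K -> cmeasurable f -> cmeasurable g ->
  (forall x, sqn (f x) <= K) -> (L2sq (f \* g) <= K%:E * L2sq g)%E.
Proof.
move=> K0 mf mg fK.
have := @L2sq_le_lin (f \* g) g g K 0 K0 (lexx _).
rewrite mul0e adde0; apply => //; first exact: cmeasurableM.
by move=> x; rewrite mul0r addr0 sqnM ler_wpM2r// sqn_ge0.
Qed.

Lemma L2sq_cvg0 (f_ : nat -> T -> R[i]) f (G : T -> R) :
  (forall n, cmeasurable (f_ n)) -> cmeasurable f ->
  mu.-integrable setT (EFin \o G) ->
  (forall n x, sqn (f x - f_ n x) <= G x) ->
  {ae mu, forall x, (fun n => sqn (f x - f_ n x)) @ \oo --> 0} ->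
  (fun n => L2sq (f \- f_ n)) @ \oo --> 0%E.
Proof.
move=> mf_ mf iG fG cv.
have [//||||_ _] := @dominated_convergence _ T R mu setT measurableT
  (fun n x => (sqn (f x - f_ n x))%:E) (cst 0%E) (EFin \o G) _ _ _ iG.
- move=> n; apply/measurable_EFinP.
  by apply: (@measurable_sqn (f \- f_ n)); exact: cmeasurableB.
- exact: measurable_cst.
- apply: filterS cv => x cvx _.
  exact: (cvg_EFin (@nearW _ _ _ _ (fun n => _)) cvx).
- apply: aeW => x n _ /=.
  by rewrite lee_fin ger0_norm// sqn_ge0.
by rewrite integral0.
Qed.

Lemma L2sq_cvg0_ex (f_ : nat -> T -> R[i]) f (e : R) : 0 < e ->
  (fun n => L2sq (f \- f_ n)) @ \oo --> 0%E ->
  exists n, (L2sq (f \- f_ n) <= e%:E)%E.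
Proof.
move=> e0 /fine_cvgP[fin /cvgrPdist_lt /(_ _ e0) H].
near \oo => n; exists n.
have Fn : L2sq (f \- f_ n) \is a fin_num by near: n; exact: fin.
rewrite -(fineK Fn) lee_fin ltW//.
have : `|0 - fine (L2sq (f \- f_ n))| < e by near: n.
by rewrite sub0r normrN; apply: le_lt_trans; exact: ler_norm.
Unshelve. all: by end_near. Qed.

Variable A : set (T -> R[i]).
Hypothesis A_meas : forall p, A p -> cmeasurable p.
Hypothesis A_bounded : forall p, A p -> exists2 K, 0 < K & forall x, sqn (p x) <= K.
Hypothesis A_cst : forall c, A (fun=> c).
Hypothesis A_add : forall p q, A p -> A q -> A (p \+ q).
Hypothesis A_mul : forall p q, A p -> A q -> A (p \* q).

Definition L2closure f := cmeasurable f /\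
  forall e : R, 0 < e -> exists2 p, A p & (L2sq (f \- p) <= e%:E)%E.

Lemma L2closure_sub p : A p -> L2closure p.
Proof.
move=> Ap; split; first exact: A_meas.
move=> e e0; exists p => //; rewrite /L2sq integral0_eq ?lee_fin ?ltW//.
by move=> x _ /=; rewrite subrr sqn0.
Qed.

Lemma L2closureD f g : L2closure f -> L2closure g -> L2closure (f \+ g).
Proof.
move=> [mf cf] [mg cg]; split; first exact: cmeasurableD.
(* The two errors enter [L2sqD] with a factor 2 each, and 2 (e/4) + 2 (e/4) = e. *)
move=> e e0; have e4 : 0 < e / 4 by rewrite divr_gt0.
have [p Ap fp] := cf _ e4; have [q Aq gq] := cg _ e4.
exists (p \+ q); first exact: A_add.
have -> : (f \+ g) \- (p \+ q) = (f \- p) \+ (g \- q).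
  by apply/funext => x /=; rewrite opprD addrACA.
apply: le_trans (L2sqD _ _) _; [exact: cmeasurableB (A_meas _)..|].
apply: (@le_trans _ _ (2%:E * (e / 4)%:E + 2%:E * (e / 4)%:E)%E).
  by apply: leeD; rewrite lee_wpmul2l.
by rewrite -!EFinM -EFinD lee_fin; lra.
Qed.

Lemma L2closure_lim f : cmeasurable f ->
  (forall e : R, 0 < e -> exists2 g, L2closure g & (L2sq (f \- g) <= e%:E)%E) ->
  L2closure f.
Proof.
move=> mf H; split => // e e0; have e4 : 0 < e / 4 by rewrite divr_gt0.
have [g [mg cg] fg] := H _ e4; have [p Ap gp] := cg _ e4.
exists p => //; have -> : f \- p = (f \- g) \+ (g \- p).
  by apply/funext => x /=; rewrite addrA subrK.
apply: le_trans (L2sqD _ _) _;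
  [exact: cmeasurableB | exact: cmeasurableB (A_meas _)|].
apply: (@le_trans _ _ (2%:E * (e / 4)%:E + 2%:E * (e / 4)%:E)%E).
  by apply: leeD; rewrite lee_wpmul2l.
by rewrite -!EFinM -EFinD lee_fin; lra.
Qed.

Lemma ae_eq_L2closure f g : cmeasurable f -> L2closure g ->
  {ae mu, forall x, f x = g x} -> L2closure f.
Proof.
move=> mf [mg cg] fg; split => // e e0; have [p Ap gp] := cg _ e0.
exists p => //; rewrite (@ae_eq_L2sq _ (g \- p))//.
- by apply: cmeasurableB => //; exact: A_meas.
- by apply: cmeasurableB => //; exact: A_meas.
- by apply: filterS fg => x /= ->.
Qed.

(** The approximation of [f] is chosen first: the accuracy needed for [g]
    depends on a bound for it. *)
Lemma L2closureM f g (K : R) : 0 < K -> (forall x, sqn (g x) <= K) ->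
  L2closure f -> L2closure g -> L2closure (f \* g).
Proof.
move=> K0 gK [mf cf] [mg cg]; split; first exact: cmeasurableM.
move=> e e0; have e1 : 0 < e / (4 * K) by rewrite divr_gt0 ?mulr_gt0.
have [p Ap fp] := cf _ e1; have [M M0 pM] := A_bounded Ap.
have e2 : 0 < e / (4 * M) by rewrite divr_gt0 ?mulr_gt0.
have [q Aq gq] := cg _ e2; exists (p \* q); first exact: A_mul.
have -> : (f \* g) \- (p \* q) = (g \* (f \- p)) \+ (p \* (g \- q)).
  by apply/funext => x /=; ring.
have mp := A_meas Ap; have mq := A_meas Aq.
apply: le_trans (L2sqD _ _) _; [by apply: cmeasurableM => //; exact: cmeasurableB..|].
apply: (@le_trans _ _ (2%:E * (K * (e / (4 * K)))%:E + 2%:E * (M * (e / (4 * M)))%:E)%E).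
  apply: leeD; rewrite lee_wpmul2l// EFinM.
    apply: (le_trans (@L2sqM_le K _ _ (ltW K0) _ _ gK)) => //.
      exact: cmeasurableB.
    by rewrite lee_wpmul2l// lee_fin ltW.
  apply: (le_trans (@L2sqM_le M _ _ (ltW M0) _ _ pM)) => //.
    exact: cmeasurableB.
  by rewrite lee_wpmul2l// lee_fin ltW.
rewrite -!EFinM -EFinD lee_fin.
have -> : K * (e / (4 * K)) = e / 4 by field; rewrite gt_eqF.
have -> : M * (e / (4 * M)) = e / 4 by field; rewrite gt_eqF.
lra.
Qed.

Lemma L2closureZ f (c : R[i]) : L2closure f -> L2closure (fun x => c * f x).
Proof.
move=> cf; rewrite (_ : (fun x => _) = f \* (fun=> c)).
  apply: (@L2closureM _ _ (1 + sqn c)) => //.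
  - by rewrite ltr_pwDl// sqn_ge0.
  - by move=> x; rewrite lerDr.
  - exact/L2closure_sub/A_cst.
by apply/funext => x /=; rewrite mulrC.
Qed.

Lemma L2closureB f g : L2closure f -> L2closure g -> L2closure (f \- g).
Proof.
move=> cf cg; rewrite (_ : f \- g = f \+ (fun x => -1 * g x)).
  by apply: L2closureD => //; exact: L2closureZ.
by apply/funext => x /=; rewrite mulN1r.
Qed.

Lemma L2closure_sum (I : Type) (s : seq I) (P : pred I) (F : I -> T -> R[i]) :
  (forall i, L2closure (F i)) ->
  L2closure (fun x => \sum_(i <- s | P i) F i x).
Proof.
move=> cF; elim: s => [|i s ih].
  rewrite (_ : (fun x => _) = fun=> 0); first exact/L2closure_sub/A_cst.
  by apply/funext => x; rewrite big_nil.
have [Pi|Pi] := boolP (P i).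
  rewrite (_ : (fun x => _) = F i \+ fun x => \sum_(j <- s | P j) F j x).
    exact: L2closureD.
  by apply/funext => x; rewrite big_cons Pi.
rewrite (_ : (fun x => _) = fun x => \sum_(j <- s | P j) F j x)//.
by apply/funext => x; rewrite big_cons (negbTE Pi).
Qed.

Definition cindic (B : set T) : T -> R[i] := fun x => (\1_B x)%:C%C.

Definition L2closure_set (B : set T) := measurable B /\ L2closure (cindic B).

Lemma cindic_le1 B x : sqn (cindic B x) <= 1.
Proof. by rewrite sqn_real indicE; case: (_ \in _) => /=; rewrite ?expr1n ?expr0n. Qed.

Lemma cmeasurable_cindic B : measurable B -> cmeasurable (cindic B).
Proof. by move=> mB; apply: cmeasurable_real; exact: measurable_indic. Qed.

Lemma L2closure_setC B : L2closure_set B -> L2closure_set (~` B).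
Proof.
move=> [mB cB]; split; first exact: measurableC.
rewrite (_ : cindic _ = (fun=> 1) \- cindic B).
  by apply: L2closureB => //; exact/L2closure_sub/A_cst.
apply/funext => x; rewrite /cindic /= !indicE in_setC.
by case: (_ \in _) => /=; rewrite ?subrr ?subr0.
Qed.

Lemma L2closure_setI B C : L2closure_set B -> L2closure_set C ->
  L2closure_set (B `&` C).
Proof.
move=> [mB cB] [mC cC]; split; first exact: measurableI.
rewrite (_ : cindic _ = cindic B \* cindic C).
  by apply: (@L2closureM _ _ 1) => //; exact: cindic_le1.
apply/funext => x; rewrite /cindic /= !indicE in_setI /=.
by case: (_ \in B) => /=; rewrite ?mul1r ?mul0r.
Qed.

(** Intersections come from [L2closureM], so no monotone class argument is
    needed. *)
Lemma L2closure_set_sigma_algebra : sigma_algebra setT L2closure_set.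
Proof.
have c0 : L2closure_set set0.
  split => //; rewrite (_ : cindic _ = fun=> 0); first exact/L2closure_sub/A_cst.
  by apply/funext => x; rewrite /cindic indic0.
split => //.
  by move=> B cB; rewrite setTD; exact: L2closure_setC.
move=> B cB; pose C n := \big[setU/set0]_(k < n) B k.
have cC n : L2closure_set (C n).
  rewrite /C; elim: n => [|n ih]; first by rewrite big_ord0.
  rewrite big_ord_recr /= -[X in L2closure_set X]setCK setCU.
  by apply: L2closure_setC; apply: L2closure_setI; exact: L2closure_setC.
have mB : measurable (\bigcup_k B k).
  by apply: bigcupT_measurable => k; case: (cB k).
split => //; apply: L2closure_lim; first exact: cmeasurable_cindic.
move=> e e0.
have : (fun n => L2sq (cindic (\bigcup_k B k) \- cindic (C n))) @ \oo --> 0%E.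
  apply: (@L2sq_cvg0 _ _ (cst 4)).
  - by move=> n; apply: cmeasurable_cindic; case: (cC n).
  - exact: cmeasurable_cindic.
  - exact: finite_measure_integrable_cst.
  - move=> n x; apply: le_trans (sqnD_le _ _) _; rewrite sqnN.
    by have := cindic_le1 (\bigcup_k B k) x; have := cindic_le1 (C n) x; rewrite /cst; lra.
  - apply: aeW => x; apply: cvg_near_cst.
    have [[k _ Bkx]|nB] := pselect ((\bigcup_k B k) x).
      near=> n; rewrite /cindic !indicE.
      rewrite (mem_set (ex_intro2 _ _ k I Bkx)).
      rewrite mem_set ?subrr ?sqn0 // /C -bigcup_mkord; exists k => //=.
      by near: n; exact: nbhs_infty_gt.
    near=> n; rewrite /cindic !indicE memNset// memNset ?subrr ?sqn0//.
    by rewrite /C -bigcup_mkord => -[k _ Bkx]; apply: nB; exists k.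
move=> /(L2sq_cvg0_ex e0)[n ?]; exists (cindic (C n)) => //.
by case: (cC n).
Unshelve. all: by end_near. Qed.

Hypothesis A_gen : @measurable _ T `<=` L2closure_set.

(** The dyadic simple functions below [u] lie in the closure because their level sets are
    measurable; they converge to [u] pointwise, and [u ^ 2] dominates the squared errors. *)
Lemma L2closure_nneg (u : T -> R) : measurable_fun setT u -> (forall x, 0 <= u x) ->
  mu.-integrable setT (EFin \o (fun x => u x ^+ 2)) ->
  L2closure (fun x => (u x)%:C%C).
Proof.
move=> mu_ u0 iu.
have mE : measurable_fun setT (EFin \o u) by exact/measurable_EFinP.
have u0' x : [set: T] x -> (0 <= (EFin \o u) x)%E by rewrite lee_fin.
pose h := approx setT (EFin \o u).
have hu x : (fun n => h n x) @ \oo --> u x.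
  exact: (@cvg_approx _ _ _ setT (EFin \o u) x u0' I (ltry _)).
have hle n x : 0 <= h n x <= u x.
  apply/andP; split; last by rewrite -lee_fin; exact: le_approx.
  by apply: addr_ge0 => //; apply: sumr_ge0 => i _; rewrite mulr_ge0.
have ch n : L2closure (fun x => (h n x)%:C%C).
  rewrite /h; under eq_fun do rewrite /approx rmorphD rmorph_sum /= rmorphM.
  apply: L2closureD.
    apply: L2closure_sum => i.
    under eq_fun do rewrite rmorphM.
    apply: L2closureZ; apply: (A_gen _).2.
    rewrite /dyadic_approx; case: ifPn => // kn; rewrite -preimage_comp.
    by apply: mE => //; apply/measurable_image_EFin; exact: measurable_itv.
  by apply: L2closureZ; apply: (A_gen _).2; exact: emeasurable_fun_c_infty.
apply: L2closure_lim; first exact: cmeasurable_real.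
move=> e e0.
have : (fun n => L2sq ((fun x => (u x)%:C%C) \- (fun x => (h n x)%:C%C))) @ \oo --> 0%E.
  apply: (@L2sq_cvg0 _ _ (fun x => u x ^+ 2)) => //.
  - by move=> n; exact: (ch n).1.
  - exact: cmeasurable_real.
  - move=> n x; rewrite -rmorphB sqn_real.
    have /andP[h0 h1] := hle n x.
    by rewrite lerXn2r ?nnegrE ?subr_ge0// gerBl.
  - apply: aeW => x.
    rewrite [X in X @ _ --> _](_ : _ = (fun n => (u x - h n x) * (u x - h n x))).
      2: by apply/funext => n; rewrite -rmorphB sqn_real expr2.
    have c : (fun n => u x - h n x) @ \oo --> 0.
      by rewrite -(subrr (u x)); apply: cvgB => //; exact: cvg_cst.
    have cc : (fun n => (u x - h n x) * (u x - h n x)) @ \oo --> 0 * (0 : R).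
      exact: cvgM.
    by rewrite mulr0 in cc.
by move=> /(L2sq_cvg0_ex e0)[n ?]; exists (fun x => (h n x)%:C%C).
Qed.

(** Domination by [f] makes the squares of the positive and negative parts of [u] integrable. It is
    meant for [u] the real or the imaginary part of [f]. *)
Lemma L2closure_real (u : T -> R) f : measurable_fun setT u -> cmeasurable f ->
  (L2sq f < +oo)%E -> (forall x, u x ^+ 2 <= sqn (f x)) ->
  L2closure (fun x => (u x)%:C%C).
Proof.
move=> mu_ mf ff uf.
have H (v : T -> R) : measurable_fun setT v -> (forall x, 0 <= v x) ->
    (forall x, v x ^+ 2 <= u x ^+ 2) -> L2closure (fun x => (v x)%:C%C).
  move=> mv v0 vu; apply: L2closure_nneg => //.
  have mv2 : measurable_fun setT (fun x => v x ^+ 2) by exact: measurable_funX.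
  apply/integrableP; split; first exact/measurable_EFinP.
  apply: le_lt_trans ff; apply: ge0_le_integral => //.
  - exact/measurable_EFinP/measurableT_comp.
  - by apply/measurable_EFinP; exact: measurable_sqn.
  - move=> x _ /=; rewrite lee_fin ger0_norm ?sqr_ge0//.
    exact: le_trans (vu x) (uf x).
rewrite (_ : (fun x => _) =
  (fun x => (Num.max (u x) 0)%:C%C) \- (fun x => (Num.max (- u x) 0)%:C%C)).
  apply: L2closureB; apply: H.
  - exact: measurable_maxr.
  - by move=> x; rewrite le_max lexx orbT.
  - by move=> x; rewrite /Num.max; case: ifP => _; rewrite ?expr0n ?sqr_ge0.
  - by apply: measurable_maxr => //; exact: measurableT_comp.
  - by move=> x; rewrite le_max lexx orbT.
  - by move=> x; rewrite /Num.max; case: ifP => _; rewrite ?sqrrN ?expr0n ?sqr_ge0.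
apply/funext => x /=; rewrite -rmorphB; congr (_%:C)%C.
rewrite /Num.max oppr_lt0.
by case: (ltgtP 0 (u x)) => [| |<-]; rewrite ?sub0r ?opprK ?subr0 ?oppr0.
Qed.

Lemma L2closure_L2 f : cmeasurable f -> (L2sq f < +oo)%E -> L2closure f.
Proof.
move=> mf ff; have [mr mi] := mf.
rewrite (_ : f = (fun x => ((@complex.Re R \o f) x)%:C%C) \+
                 (fun x => 'i%C * ((@complex.Im R \o f) x)%:C%C)).
  apply: L2closureD; last apply: L2closureZ; apply: (L2closure_real _ mf) => //.
  - by move=> x; rewrite lerDl sqr_ge0.
  - by move=> x; rewrite lerDr sqr_ge0.
apply/funext => x /=; case: (f x) => a b.
by apply/eqP; rewrite eq_complex /=; apply/andP; split; apply/eqP; ring.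
Qed.
End Closure.
Arguments L2sq {d T R} mu f%_R.

(** * Orthogonal expansions *)

Section OrthogonalExpansion.
Context d (T : measurableType d) (R : realType).
Variable mu : {finite_measure set T -> \bar R}.
Implicit Types f g h : T -> R[i].
Local Notation Re := (@complex.Re R).
Local Notation Im := (@complex.Im R).

Definition square_integrable f := cmeasurable f /\ (L2sq mu f < +oo)%E.

Definition cdot f g : R[i] := cintegral mu (fun x => f x * conjc (g x)).

Lemma bounded_square_integrable (K : R) f : cmeasurable f ->
  (forall x, sqn (f x) <= K) -> square_integrable f.
Proof.
move=> mf fK; split => //.
apply: (@le_lt_trans _ _ (\int[mu]_x (cst K%:E) x)%E).
  apply: ge0_le_integral => //.
  - by move=> x _; rewrite lee_fin sqn_ge0.
  - by apply/measurable_EFinP; exact: measurable_sqn.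
  - by move=> x _; rewrite lee_fin.
by rewrite integral_cst// ltey_eq fin_numM ?fin_num_measure.
Qed.

Lemma square_integrableD f g : square_integrable f -> square_integrable g ->
  square_integrable (f \+ g).
Proof.
move=> [mf ff] [mg gg]; split; first exact: cmeasurableD.
by apply: le_lt_trans (L2sqD _ mf mg) _; rewrite lte_add_pinfty// lte_mul_pinfty.
Qed.

Lemma square_integrableZ (a : R[i]) f : square_integrable f ->
  square_integrable (fun x => a * f x).
Proof.
move=> [mf ff]; have ma : cmeasurable (fun _ : T => a) by exact: cmeasurable_cst.
split; first exact: (cmeasurableM ma mf).
apply: le_lt_trans (@L2sqM_le _ _ _ mu (sqn a) (fun=> a) f _ ma mf _) _ => //.
  exact: sqn_ge0.
by rewrite lte_mul_pinfty// lee_fin sqn_ge0.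
Qed.

Lemma square_integrableN f : square_integrable f -> square_integrable (\- f).
Proof.
move=> /(square_integrableZ (-1)); rewrite (_ : (fun x => _) = \- f)//.
by apply/funext => x; rewrite mulN1r.
Qed.

Lemma square_integrableB f g : square_integrable f -> square_integrable g ->
  square_integrable (f \- g).
Proof. by move=> ff gg; apply: square_integrableD => //; exact: square_integrableN. Qed.

Lemma square_integrable_sum (J : Type) (s : seq J) (a : J -> R[i])
    (u : J -> T -> R[i]) : (forall j, square_integrable (u j)) ->
  square_integrable (fun x => \sum_(j <- s) a j * u j x).
Proof.
move=> us; elim: s => [|j s ih].
  rewrite (_ : (fun x => _) = fun=> 0).
    by apply: (@bounded_square_integrable 0); [exact: cmeasurable_cst|rewrite sqn0].
  by apply/funext => x; rewrite big_nil.
rewrite (_ : (fun x => _) = (fun x => a j * u j x) \+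
    (fun x => \sum_(i <- s) a i * u i x)).
  by apply: square_integrableD => //; exact: square_integrableZ.
by apply/funext => x; rewrite big_cons.
Qed.

Lemma square_integrable_sqn f : square_integrable f ->
  mu.-integrable setT (EFin \o (sqn \o f)).
Proof.
move=> [mf ff]; apply/integrableP; split.
  by apply/measurable_EFinP; exact: measurable_sqn.
by under eq_integral do rewrite /= ger0_norm ?sqn_ge0//.
Qed.

Lemma L2sq_fin f : square_integrable f -> L2sq mu f = (fine (L2sq mu f))%:E.
Proof. by move=> [_ ff]; rewrite fineK// ge0_fin_numE// L2sq_ge0. Qed.

Lemma le_integrable_sqn (u : T -> R) f g : measurable_fun setT u ->
  square_integrable f -> square_integrable g ->
  (forall x, `|u x| <= sqn (f x) + sqn (g x)) ->
  mu.-integrable setT (EFin \o u).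
Proof.
move=> mu_ /square_integrable_sqn iff /square_integrable_sqn igg ufg.
apply: (@le_integrable _ _ _ mu setT measurableT _
  ((EFin \o (sqn \o f)) \+ (EFin \o (sqn \o g)))%E).
- exact/measurable_EFinP.
- move=> x _ /=; by rewrite lee_fin [leRHS]ger0_norm// addr_ge0 ?sqn_ge0.
- exact: (integrableD measurableT iff igg).
Qed.

(** Real and imaginary part of the product have the form a c + b e up to signs, which the
    arithmetic-geometric mean inequality bounds by the sum of the squared moduli. *)
Lemma cdot_cintegrable f g : square_integrable f -> square_integrable g ->
  cintegrable mu (fun x => f x * conjc (g x)).
Proof.
move=> ff gg; have [f1 f2] := ff.1; have [g1 g2] := gg.1.
have H (a b c e : R) : `|a * c + b * e| <= (a ^+ 2 + b ^+ 2) + (c ^+ 2 + e ^+ 2).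
  rewrite ler_norml; apply/andP; split; rewrite -subr_ge0.
    rewrite [leRHS](_ : _ = ((a + c) ^+ 2 + (b + e) ^+ 2 + a ^+ 2 + b ^+ 2
      + c ^+ 2 + e ^+ 2) / 2); last by field.
    by rewrite divr_ge0// !addr_ge0// sqr_ge0.
  rewrite [leRHS](_ : _ = ((a - c) ^+ 2 + (b - e) ^+ 2 + a ^+ 2 + b ^+ 2
    + c ^+ 2 + e ^+ 2) / 2); last by field.
  by rewrite divr_ge0// !addr_ge0// sqr_ge0.
split; apply: (le_integrable_sqn _ ff gg).
- rewrite (_ : _ \o _ = fun x => Re (f x) * Re (g x) + Im (f x) * Im (g x)).
    by apply: measurable_funD; exact: measurable_funM.
  by apply/funext => x /=; case: (f x) (g x) => ? ? [? ?] /=; ring.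
- move=> x /=; case: (f x) (g x) => a b [c e] /=.
  by rewrite mulrN opprK; exact: H.
- rewrite (_ : _ \o _ = fun x => Im (f x) * Re (g x) - Re (f x) * Im (g x)).
    by apply: measurable_funB; exact: measurable_funM.
  by apply/funext => x /=; case: (f x) (g x) => ? ? [? ?] /=; ring.
- move=> x /=; case: (f x) (g x) => a b [c e] /=.
  rewrite /sqn /= (_ : a * - e + b * c = b * c + a * - e); last by ring.
  by rewrite (addrC (a ^+ 2)) -(sqrrN e); exact: H.
Qed.

(** Integrability of the sum is carried along because additivity requires it of the tail at each
    step of the induction. *)
Lemma cintegral_sum (J : Type) (s : seq J) (a : J -> R[i]) (u : J -> T -> R[i]) :
  (forall j, cintegrable mu (u j)) ->
  cintegral mu (fun x => \sum_(j <- s) a j * u j x) =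
  \sum_(j <- s) a j * cintegral mu (u j) /\
  cintegrable mu (fun x => \sum_(j <- s) a j * u j x).
Proof.
move=> us; elim: s => [|j s [ih1 ih2]].
  rewrite (_ : (fun x => _) = cst 0); last by apply/funext => x; rewrite big_nil.
  rewrite big_nil; split; last by split; exact: integrable0.
  by rewrite /cintegral /= /Rintegral integral0.
rewrite (_ : (fun x => _) = a j *: u j +
    (fun x => \sum_(i <- s) a i * u i x)); last first.
  by apply/funext => x; rewrite big_cons.
split; first by rewrite cintegralP// big_cons ih1.
case: (us j) ih2 => [u1 u2] [v1 v2]; split.
  rewrite (_ : EFin \o _ = (fun x => ((Re (a j))%:E * (EFin \o (Re \o u j)) x
    - (Im (a j))%:E * (EFin \o (Im \o u j)) x)
    + (EFin \o (Re \o (fun x => \sum_(i <- s) a i * u i x)%R)) x)%E).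
    apply: integrableD => //; apply: integrableB => //; exact: integrableZl.
  apply/funext => x /=; rewrite -!EFinM -EFinB -EFinD; congr (_%:E).
  by rewrite /GRing.add /= /GRing.scale /=; case: (a j) (u j x) (\sum_(i <- s) _) => [? ?] [? ?] [? ?].
rewrite (_ : EFin \o _ = (fun x => ((Re (a j))%:E * (EFin \o (Im \o u j)) x
    + (Im (a j))%:E * (EFin \o (Re \o u j)) x)
    + (EFin \o (Im \o (fun x => \sum_(i <- s) a i * u i x)%R)) x)%E).
  apply: integrableD => //; apply: integrableD => //; exact: integrableZl.
apply/funext => x /=; rewrite -!EFinM -!EFinD; congr (_%:E).
by rewrite /GRing.add /= /GRing.scale /=; case: (a j) (u j x) (\sum_(i <- s) _) => [? ?] [? ?] [? ?].
Qed.

Lemma cdot_suml (J : Type) (s : seq J) (a : J -> R[i]) (u : J -> T -> R[i]) g :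
  (forall j, square_integrable (u j)) -> square_integrable g ->
  cdot (fun x => \sum_(j <- s) a j * u j x) g = \sum_(j <- s) a j * cdot (u j) g.
Proof.
move=> us gg; rewrite /cdot.
rewrite -(cintegral_sum s a (fun j => cdot_cintegrable (us j) gg)).1.
congr cintegral; apply/funext => x; rewrite mulr_suml.
by apply: eq_bigr => j _; rewrite mulrA.
Qed.

Lemma cdot_sumr (J : Type) (s : seq J) (a : J -> R[i]) (u : J -> T -> R[i]) g :
  (forall j, square_integrable (u j)) -> square_integrable g ->
  cdot g (fun x => \sum_(j <- s) a j * u j x) = \sum_(j <- s) conjc (a j) * cdot g (u j).
Proof.
move=> us gg; rewrite /cdot.
rewrite -(cintegral_sum s (fun j => conjc (a j)) (fun j => cdot_cintegrable gg (us j))).1.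
congr cintegral; apply/funext => x; rewrite rmorph_sum mulr_sumr.
by apply: eq_bigr => j _; rewrite rmorphM mulrCA.
Qed.

Lemma cdotDl f g h : square_integrable f -> square_integrable g ->
  square_integrable h -> cdot (f \+ g) h = cdot f h + cdot g h.
Proof.
move=> ff gg hh; rewrite /cdot -[cintegral _ _ in RHS]mul1r -cintegralP;
  [|exact: cdot_cintegrable..].
by congr cintegral; apply/funext => x; rewrite scale1r mulrDl.
Qed.

Lemma cdotDr f g h : square_integrable f -> square_integrable g ->
  square_integrable h -> cdot h (f \+ g) = cdot h f + cdot h g.
Proof.
move=> ff gg hh; rewrite /cdot -[cintegral _ _ in RHS]mul1r -cintegralP;
  [|exact: cdot_cintegrable..].
by congr cintegral; apply/funext => x; rewrite scale1r rmorphD mulrDr.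
Qed.

Lemma cdotNl f h : square_integrable f -> square_integrable h ->
  cdot (\- f) h = - cdot f h.
Proof.
move=> ff hh; have := @cdot_suml unit [:: tt] (fun=> -1) (fun=> f) h (fun=> ff) hh.
rewrite big_seq1 mulN1r => <-; congr cdot; apply/funext => x.
by rewrite big_seq1 mulN1r.
Qed.

Lemma L2sqDE f g : square_integrable f -> square_integrable g ->
  L2sq mu (f \+ g) =
  (L2sq mu f + L2sq mu g + (2 * Re (cdot f g))%:E)%E.
Proof.
move=> ff gg.
have iff := square_integrable_sqn ff; have igg := square_integrable_sqn gg.
have [ifg _] := cdot_cintegrable ff gg.
rewrite (L2sq_fin ff) (L2sq_fin gg) (L2sq_fin (square_integrableD ff gg)).
rewrite -!EFinD; congr (_%:E).
rewrite /L2sq -!/(Rintegral _ _ _) /cdot /=.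
rewrite -RintegralZl// -!RintegralD//.
- by apply: eq_Rintegral => x _ /=; case: (f x) (g x) => ? ? [? ?]; rewrite /sqn /=; ring.
- exact: (integrableD measurableT iff igg).
- exact: (integrableZl measurableT _ ifg).
Qed.

Lemma L2sq_cdot f : square_integrable f -> L2sq mu f = (Re (cdot f f))%:E.
Proof.
move=> ff; rewrite (L2sq_fin ff); congr (_%:E); apply: eq_Rintegral => x _ /=.
by case: (f x) => ? ?; rewrite /sqn /=; ring.
Qed.

Variables (I : choiceType) (e : I -> T -> R[i]) (M : R).
Hypothesis M_gt0 : 0 < M.
Hypothesis e_L2 : forall k, square_integrable (e k).
Hypothesis e_dot : forall k l, cdot (e k) (e l) = (k == l)%:R * M%:C%C.

(** The family is orthogonal but not normalised, hence the division by the common squared norm [M],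
    which is (2 pi)^d for the modes of the torus. *)
Definition projection (s : seq I) f : T -> R[i] :=
  fun x => \sum_(k <- s) (cdot f (e k) * (M^-1)%:C%C) * e k x.

Lemma projection_L2 s f : square_integrable (projection s f).
Proof. exact: square_integrable_sum. Qed.

Lemma cdot_projection s f k : uniq s -> k \in s ->
  cdot (projection s f) (e k) = cdot f (e k).
Proof.
move=> us ks; rewrite cdot_suml// (bigD1_seq k)//= big1 ?addr0.
  rewrite e_dot eqxx mul1r -mulrA -rmorphM mulVf ?mulr1//.
  by rewrite gt_eqF.
by move=> i ik; rewrite e_dot (negbTE ik) mul0r mulr0.
Qed.

Lemma cdot_residual s f k : uniq s -> square_integrable f -> k \in s ->
  cdot (f \- projection s f) (e k) = 0.
Proof.
move=> us ff ks; have pf := projection_L2 s f.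
rewrite cdotDl// ?cdotNl ?cdot_projection ?subrr//.
exact: square_integrableN.
Qed.

Lemma L2sq_projection s f : uniq s -> square_integrable f ->
  L2sq mu (projection s f) = (\sum_(k <- s) sqn (cdot f (e k)) / M)%:E.
Proof.
move=> us ff; rewrite L2sq_cdot; last exact: projection_L2.
rewrite {2}/projection cdot_sumr//; last exact: projection_L2.
congr (_%:E); rewrite raddf_sum; apply: eq_big_seq => k ks.
rewrite cdot_projection//; case: (cdot f (e k)) => a b.
by rewrite /sqn /=; field; rewrite gt_eqF.
Qed.

(** Pythagoras: the residual is orthogonal to each [e k] with [k] in [s], hence to the projection.
    Bessel's inequality follows by dropping the residual. *)
Lemma L2sq_residual s f : uniq s -> square_integrable f ->
  L2sq mu f = (L2sq mu (f \- projection s f) +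
               (\sum_(k <- s) sqn (cdot f (e k)) / M)%:E)%E.
Proof.
move=> us ff; have pf := projection_L2 s f; have rf := square_integrableB ff pf.
rewrite -L2sq_projection// -[RHS]adde0.
have -> : 0%E = (2 * Re (cdot (f \- projection s f) (projection s f)))%:E.
  rewrite {2}/projection cdot_sumr// big_seq big1 ?mulr0// => k ks.
  by rewrite cdot_residual// mulr0.
by rewrite -L2sqDE//; congr L2sq; apply/funext => x /=; rewrite subrK.
Qed.

(** The projection minus the competitor lies in the span of the selected [e k], to which the
    residual is orthogonal, so the squared distances add. The competitor may repeat indices, as
    lists of products do; hence [undup]. *)
Lemma projection_best (J : eqType) (l : seq J) (a : J -> R[i]) (n : J -> I) f :
  square_integrable f ->
  (L2sq mu (f \- projection (undup (map n l)) f) <=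
   L2sq mu (f \- (fun x => \sum_(j <- l) a j * e (n j) x)%R))%E.
Proof.
move=> ff; set s := undup _; have us : uniq s by exact: undup_uniq.
pose p : T -> R[i] := fun x => \sum_(j <- l) a j * e (n j) x.
rewrite -/p; have pp : square_integrable p by exact: square_integrable_sum.
have Sf := projection_L2 s f; have rf := square_integrableB ff Sf.
have qf := square_integrableB Sf pp.
have -> : f \- p = (f \- projection s f) \+ (projection s f \- p).
  by apply/funext => x /=; rewrite addrA subrK.
rewrite (L2sqDE rf qf).
have -> : cdot (f \- projection s f) (projection s f \- p) = 0.
  rewrite cdotDr//; last exact: square_integrableN.
  rewrite {2}/projection cdot_sumr// big_seq big1 ?add0r; last first.
    by move=> k ks; rewrite cdot_residual// mulr0.
  rewrite (_ : (fun x => - p x) = fun x => \sum_(j <- l) (- a j) * e (n j) x).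
    2: by apply/funext => x /=; rewrite -sumrN; apply: eq_bigr => j _; rewrite mulNr.
  rewrite cdot_sumr// big_seq big1// => j jl.
  by rewrite cdot_residual ?mulr0// mem_undup map_f.
by rewrite mulr0 adde0 leeDl// L2sq_ge0.
Qed.

Hypothesis e_dense : forall f, square_integrable f -> forall eps : R, 0 < eps ->
  exists l : seq (R[i] * I),
    (L2sq mu (f \- (fun x => \sum_(t <- l) t.1 * e t.2 x)%R) <= eps%:E)%E.

(** One inequality is Bessel's on finite sets of indices. For the other, [projection_best] replaces
    the approximant of [e_dense] by the projection onto its own indices, whose residual is then at
    most [eps]. *)
Lemma parseval f : square_integrable f ->
  L2sq mu f = \esum_(k in [set: I]) (sqn (cdot f (e k)) / M)%:E.
Proof.
move=> ff; have H k : 0 <= sqn (cdot f (e k)) / M by rewrite divr_ge0 ?sqn_ge0 ?ltW.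
apply/eqP; rewrite eq_le; apply/andP; split; last first.
  apply: ge_ereal_sup => _ [X [finX _] <-].
  rewrite fsbig_finite//= sumEFin (L2sq_residual (finmap.fset_uniq (fset_set X)) ff)//.
  by rewrite leeDr// L2sq_ge0.
apply/lee_addgt0Pr => eps eps0.
have [l lf] := e_dense ff eps0.
rewrite (L2sq_residual (undup_uniq (map snd l)) ff) addeC leeD//.
  apply: esum_ge; exists [set` undup (map snd l)]; first by split.
  by rewrite -fsbig_seq ?undup_uniq// sumEFin.
by apply: le_trans lf; exact: (@projection_best _ l fst snd).
Qed.
End OrthogonalExpansion.

(** * Integrals over powers of the circle *)

Section ProductIntegral.
Context d1 d2 (T1 : measurableType d1) (T2 : measurableType d2) (R : realType).
Variables (m1 : {finite_measure set T1 -> \bar R})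
  (m2 : {finite_measure set T2 -> \bar R}).
Local Notation Re := (@complex.Re R).
Local Notation Im := (@complex.Im R).

(** Tonelli for the absolute values gives integrability on the product, then Fubini gives the
    value. *)
Lemma Rintegral_prodM (a : T1 -> R) (b : T2 -> R) :
  m1.-integrable setT (EFin \o a) -> m2.-integrable setT (EFin \o b) ->
  (m1 \x m2)%E.-integrable setT (EFin \o (fun z => a z.1 * b z.2)) /\
  Rintegral (m1 \x m2)%E setT (fun z => a z.1 * b z.2) =
  Rintegral m1 setT a * Rintegral m2 setT b.
Proof.
move=> ia ib.
have ma : measurable_fun setT a by apply/measurable_EFinP; exact: measurable_int ia.
have mb : measurable_fun setT b by apply/measurable_EFinP; exact: measurable_int ib.
have mab : measurable_fun setT (EFin \o (fun z : T1 * T2 => a z.1 * b z.2)).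
  by apply/measurable_EFinP; apply: measurable_funM; exact: measurableT_comp.
have iab : (m1 \x m2)%E.-integrable setT (EFin \o (fun z => a z.1 * b z.2)).
  apply/(integrable12ltyP m1 m2 mab) => /=.
  have /integrableP[_ fb] := ib; have /integrableP[_ fa] := ia.
  pose c := fine (\int[m2]_y `|(EFin \o b) y|)%E.
  have cE : (\int[m2]_y `|(EFin \o b) y|)%E = c%:E.
    by rewrite fineK// ge0_fin_numE// integral_ge0.
  have c0 : 0 <= c by rewrite fine_ge0// integral_ge0.
  rewrite (eq_integral (fun x => `|(EFin \o a) x| * c%:E)%E); last first.
    move=> x _; rewrite (eq_integral (fun y => `|a x|%:E * `|(EFin \o b) y|)%E).
      rewrite ge0_integralZl ?cE//.
      by apply/measurable_EFinP; exact: measurableT_comp.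
    by move=> y _; rewrite /= normrM EFinM.
  rewrite ge0_integralZr//.
  - by rewrite muleC lte_mul_pinfty.
  - by apply/measurable_EFinP; exact: measurableT_comp.
split=> //; rewrite {1}/Rintegral -(integral12_prod_meas1 iab).
have fb := integrable_fin_num measurableT ib.
rewrite (eq_integral (fun x => (EFin \o a) x * (Rintegral m2 setT b)%:E)%E).
  by rewrite integralZr// fineM// integrable_fin_num.
move=> x _; rewrite /fubini_F /= (eq_integral (fun y => (a x)%:E * (EFin \o b) y)%E).
  by rewrite integralZl// /Rintegral fineK.
by move=> y _ /=; rewrite EFinM.
Qed.

Lemma cintegral_prodM (u : T1 -> R[i]) (v : T2 -> R[i]) :
  cintegrable m1 u -> cintegrable m2 v ->
  cintegrable (m1 \x m2)%E (fun z => u z.1 * v z.2) /\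
  cintegral (m1 \x m2)%E (fun z => u z.1 * v z.2) =
  cintegral m1 u * cintegral m2 v.
Proof.
move=> [u1 u2] [v1 v2].
have [i11 e11] := Rintegral_prodM u1 v1; have [i12 e12] := Rintegral_prodM u1 v2.
have [i21 e21] := Rintegral_prodM u2 v1; have [i22 e22] := Rintegral_prodM u2 v2.
have E1 : Re \o (fun z => u z.1 * v z.2) = fun z =>
    (Re \o u) z.1 * (Re \o v) z.2 -
    (Im \o u) z.1 * (Im \o v) z.2.
  by apply/funext => z /=; case: (u z.1) (v z.2) => [? ?] [? ?].
have E2 : Im \o (fun z => u z.1 * v z.2) = fun z =>
    (Re \o u) z.1 * (Im \o v) z.2 +
    (Im \o u) z.1 * (Re \o v) z.2.
  by apply/funext => z /=; case: (u z.1) (v z.2) => [? ?] [? ?].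
split.
  by split; rewrite ?E1 ?E2;
    [exact: (integrableB measurableT i11 i22)|exact: (integrableD measurableT i12 i21)].
have R1 := RintegralB measurableT i11 i22.
have R2 := RintegralD measurableT i12 i21.
rewrite e11 e22 -E1 in R1; rewrite e12 e21 -E2 in R2.
by rewrite /cintegral [X in (X +i* _)%C]R1 [X in (_ +i* X)%C]R2.
Qed.
End ProductIntegral.

Lemma cmeasurable_prod d (T : measurableType d) (R : realType) (J : Type) (s : seq J) (u : J -> T -> R[i]) :
  (forall j, cmeasurable (u j)) -> cmeasurable (fun x => \prod_(j <- s) u j x).
Proof.
move=> mu_; elim: s => [|j s ih].
  by under eq_fun do rewrite big_nil; exact: cmeasurable_cst.
by under eq_fun do rewrite big_cons; exact: (cmeasurableM (mu_ j) ih).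
Qed.

Section PowerMeasure.
Context d (T : measurableType d) (R : realType).

Lemma cintegrable_cmeasurable (m : {finite_measure set T -> \bar R}) (f : T -> R[i]) :
  cintegrable m f -> cmeasurable f.
Proof. by move=> [f1 f2]; split; apply/measurable_EFinP; [exact: measurable_int f1|exact: measurable_int f2]. Qed.

Variable m : {finite_measure set T -> \bar R}.

Lemma cintegral_cons n (m2 : {finite_measure set (n.-tuple T) -> \bar R})
    (f : n.+1.-tuple T -> R[i]) : cmeasurable f ->
  cintegrable (m \x m2)%E (f \o @Defs.cons_tuple d T n) ->
  cintegrable (cons_measure m m2) f /\
  cintegral (cons_measure m m2) f = cintegral (m \x m2)%E (f \o @Defs.cons_tuple d T n).
Proof.
move=> [f1 f2] [i1 i2]; have mc := @measurable_cons_tuple _ T n.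
have /measurable_EFinP m1' := f1; have /measurable_EFinP m2' := f2.
split; first split.
- exact: (integrable_pushforward mc m1' (D := setT)).
- exact: (integrable_pushforward mc m2' (D := setT)).
rewrite /cintegral /Rintegral; congr (fine _ +i* fine _)%C.
  exact: (integral_pushforward mc m1' (D := setT)).
exact: (integral_pushforward mc m2' (D := setT)).
Qed.

(** Fubini, one coordinate at a time; integrability is part of the conclusion because the next step
    of the induction consumes it. *)
Lemma cintegral_power n (u : 'I_n -> T -> R[i]) :
  (forall j, cintegrable m (u j)) ->
  cintegrable (power_measure m n) (fun x => \prod_(j < n) u j (tnth x j)) /\
  cintegral (power_measure m n) (fun x => \prod_(j < n) u j (tnth x j)) =
  \prod_(j < n) cintegral m (u j).
Proof.
elim: n u => [|n ih] u iu.
  rewrite (_ : (fun x => _) = cst 1); last by apply/funext => x; rewrite big_ord0.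
  split; first by split; exact: finite_measure_integrable_cst.
  rewrite big_ord0 /cintegral /= /Rintegral.
  rewrite !integral_dirac//=.
by rewrite indicT mulr1 mulr0.
have [iv ev] := ih (fun j => u (lift ord0 j)) (fun j => iu _).
have [iw ew] := cintegral_prodM (iu ord0) iv.
rewrite big_ord_recl -ev -ew.
pose f (x : n.+1.-tuple T) := \prod_(j < n.+1) u j (tnth x j).
pose g z := u ord0 z.1 * \prod_(j < n) u (lift ord0 j) (tnth z.2 j).
rewrite -/f -/g in iw ew *.
have fg : f \o (@Defs.cons_tuple d T n) = g.
  apply/funext => -[x y]; rewrite /f /g /= big_ord_recl; congr (_ * _).
  by apply: eq_bigr => j _; rewrite tnthS.
have mf : cmeasurable f.
  apply: cmeasurable_prod => j; have [u1 u2] := cintegrable_cmeasurable (iu j).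
  by split; [apply: (measurableT_comp u1)|apply: (measurableT_comp u2)]; exact: measurable_tnth.
rewrite -fg in iw ew *; have [if_ ef] := cintegral_cons mf iw.
by split => //; rewrite -ew; exact: ef.
Qed.

(** Allows discarding the points of the torus with one coordinate in a null set of the circle: an
    endpoint of the period, the jump of a half space, or the outside of the period. *)
Lemma power_measure_null n (B : set T) (j : 'I_n) : measurable B -> m B = 0%E ->
  power_measure m n [set x | B (tnth x j)] = 0%E.
Proof.
move=> mB B0; elim: n j => [[]//|n ih] j.
rewrite -[LHS]/((m \x power_measure m n)%E
  (@Defs.cons_tuple d T n @^-1` [set x | B (tnth x j)])).
have mP (i : 'I_n) : measurable [set x : n.-tuple T | B (tnth x i)].
  by rewrite -[X in measurable X]setTI; exact: measurable_tnth.
case: (unliftP ord0 j) => [i|] ->.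
  rewrite (_ : _ @^-1` _ = setT `*` [set x | B (tnth x i)]).
    have -> := product_measure1E m (power_measure m n) measurableT (mP i).
    by rewrite -[RHS](mule0 (m setT)); congr (_ * _)%E; exact: ih.
  by apply/seteqP; split => -[x y] /=; rewrite tnthS// => -[].
rewrite (_ : _ @^-1` _ = B `*` setT).
  have -> := product_measure1E m (power_measure m n) mB measurableT.
  by rewrite -[RHS](mul0e (power_measure m n setT)); congr (_ * _)%E.
by apply/seteqP; split => -[x y] /=; rewrite tnth0// => -[].
Qed.
End PowerMeasure.

(** * Exponentials on the circle *)

Section Circle.
Variable R : realType.
Local Notation m := (circle_measure R).
Local Notation lambda := (@lebesgue_measure R).

Lemma circle_measure_null (B : set (measurableTypeR R)) : measurable B ->
  lambda (B `&` `[0, 2 * pi]) = 0%E -> m B = 0%E.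
Proof. by []. Qed.

Lemma Rintegral_circle (f : measurableTypeR R -> R) :
  m.-integrable setT (EFin \o f) ->
  Rintegral m setT f = Rintegral lambda `[0, 2 * pi] f.
Proof.
move=> if_.
have mI : measurable (`[0, 2 * pi] : set (measurableTypeR R)) by exact: measurable_itv.
have mE : measurable (~` `[0, 2 * pi] : set (measurableTypeR R)) by exact: measurableC.
rewrite /Rintegral (negligible_integral mE measurableT if_); last first.
  by apply: circle_measure_null => //; rewrite setICl measure0.
rewrite setTD setCK; congr fine; apply: eq_measure_integral => A mA AI.
by rewrite /= /mfrestr /mrestr setIidl.
Qed.

Lemma Rintegral_antiderivative (F f : R -> R) : continuous f ->
  (forall x : R, is_derive x (1 : R) F (f x)) ->
  Rintegral lambda `[0, 2 * pi] f = F (2 * pi) - F 0.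
Proof.
move=> cf dF; have cF : continuous F.
  by move=> x; apply: differentiable_continuous; apply/derivable1_diffP; have [] := dF x.
rewrite /Rintegral (@continuous_FTC2 R f F)//.
- by rewrite mulr_gt0// pi_gt0.
- exact: continuous_subspaceT.
- split; first by move=> x _; have [] := dF x.
  + exact: cvg_at_right_filter (cF 0).
  + exact: cvg_at_left_filter (cF (2 * pi)).
- by move=> x _; rewrite derive1E; have [_] := dF x.
Qed.

Lemma sin_2piM (n : int) : sin (n%:~R * (2 * pi)) = 0 :> R.
Proof.
have H (k : nat) : sin (k%:R * (2 * pi)) = 0 :> R.
  elim: k => [|k ih]; first by rewrite mul0r sin0.
  by rewrite -natr1 mulrDl mul1r [X in _ + X](_ : _ = pi *+ 2) ?sinD2pi// mulr_natl.
case: n => k; first exact: H.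
by rewrite NegzE intrN mulNr sinN -pmulrn H oppr0.
Qed.

Lemma cos_2piM (n : int) : cos (n%:~R * (2 * pi)) = 1 :> R.
Proof.
have H (k : nat) : cos (k%:R * (2 * pi)) = 1 :> R.
  elim: k => [|k ih]; first by rewrite mul0r cos0.
  by rewrite -natr1 mulrDl mul1r [X in _ + X](_ : _ = pi *+ 2) ?cosD2pi// mulr_natl.
case: n => k; first exact: H.
by rewrite NegzE intrN mulNr cosN -pmulrn H.
Qed.

Lemma continuous_scale_cos (a : R) : continuous (fun x => cos (a * x)).
Proof. by move=> x; apply: continuous_comp; [exact: mulrl_continuous|exact: continuous_cos]. Qed.

Lemma continuous_scale_sin (a : R) : continuous (fun x => sin (a * x)).
Proof. by move=> x; apply: continuous_comp; [exact: mulrl_continuous|exact: continuous_sin]. Qed.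

Lemma Rintegral_cos (n : int) : n != 0 ->
  Rintegral lambda `[0, 2 * pi] (fun x => cos (n%:~R * x)) = 0.
Proof.
move=> n0; have nR : n%:~R != 0 :> R by rewrite intr_eq0.
have D (x : R) : is_derive x (1 : R) (fun x : R => n%:~R^-1 * sin (n%:~R * x)) (cos (n%:~R * x)).
  by apply: is_derive_eq; rewrite /GRing.scale /= mulr1; field.
rewrite (Rintegral_antiderivative (@continuous_scale_cos _) D).
by rewrite sin_2piM !mulr0 sin0 mulr0 subrr.
Qed.

Lemma Rintegral_sin (n : int) :
  Rintegral lambda `[0, 2 * pi] (fun x => sin (n%:~R * x)) = 0.
Proof.
have [->|n0] := eqVneq n 0.
  under eq_Rintegral do rewrite mul0r sin0.
  by rewrite /Rintegral integral0.
have nR : n%:~R != 0 :> R by rewrite intr_eq0.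
have D (x : R) : is_derive x (1 : R) (fun x : R => - n%:~R^-1 * cos (n%:~R * x)) (sin (n%:~R * x)).
  by apply: is_derive_eq; rewrite /GRing.scale /= mulr1; field.
rewrite (Rintegral_antiderivative (@continuous_scale_sin _) D).
by rewrite cos_2piM mulr0 cos0 subrr.
Qed.

Lemma cintegral_expi (n : int) :
  cintegrable m (fun x => expi (n%:~R * x)) /\
  cintegral m (fun x => expi (n%:~R * x)) = (n == 0)%:R * (2 * pi)%:C%C.
Proof.
have H (f : measurableTypeR R -> R) : measurable_fun setT f ->
    (forall x, `|f x| <= 1) -> m.-integrable setT (EFin \o f).
  move=> mf f1; apply: (measurable_bounded_integrable measurableT).
  - by rewrite ltey_eq fin_num_measure.
  - exact: mf.
  - by exists 1; split => // M M1 x _; apply: le_trans (ltW M1).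
have ic : m.-integrable setT (EFin \o (fun x => cos (n%:~R * x))).
  apply: H => [|x]; last by rewrite ler_norml cos_geN1 cos_le1.
  by apply: continuous_measurable_fun; exact: continuous_scale_cos.
have is_ : m.-integrable setT (EFin \o (fun x => sin (n%:~R * x))).
  apply: H => [|x]; last by rewrite ler_norml sin_geN1 sin_le1.
  by apply: continuous_measurable_fun; exact: continuous_scale_sin.
split; first by [].
rewrite /cintegral.
rewrite [X in (X +i* _)%C](Rintegral_circle ic) [X in (_ +i* X)%C](Rintegral_circle is_).
rewrite Rintegral_sin; have [->|n0] := eqVneq n 0; last by rewrite Rintegral_cos// mul0r.
under eq_Rintegral do rewrite mul0r cos0.
have D (x : R) : is_derive x (1 : R) (@id R) 1 by exact: is_derive_id.
have cst1 : continuous (fun _ : R => 1 : R) by move=> x; exact: cvg_cst.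
by rewrite (Rintegral_antiderivative cst1 D) subr0 mul1r.
Qed.

End Circle.

(** * Trigonometric polynomials are dense on the torus *)

Section Exponential.
Context {R : realType}.
Implicit Types a b : R.

Lemma expiD a b : expi (a + b) = expi a * expi b.
Proof.
apply/eqP; rewrite eq_complex /= cosD sinD eqxx /=.
by apply/eqP; ring.
Qed.

Lemma conjc_expi a : conjc (expi a) = expi (- a).
Proof. by rewrite /expi /= cosN sinN. Qed.

Lemma sqn_expi a : sqn (expi a) = 1.
Proof. by rewrite /sqn /= cos2Dsin2. Qed.

Lemma expi0 : expi (0 : R) = 1.
Proof. by rewrite /expi cos0 sin0. Qed.

Lemma expi_sum (J : Type) (s : seq J) (F : J -> R) :
  expi (\sum_(j <- s) F j) = \prod_(j <- s) expi (F j).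
Proof. by apply: (big_morph (@expi R)) => //; [exact: expiD|exact: expi0]. Qed.

Lemma bernoulli_inequality (y : R) (m : nat) : -1 <= y ->
  1 + m%:R * y <= (1 + y) ^+ m.
Proof.
move=> y1; elim: m => [|m ih]; first by rewrite mul0r addr0 expr0.
rewrite exprS; apply: (@le_trans _ _ ((1 + y) * (1 + m%:R * y))).
  rewrite -natr1 -subr_ge0 [leRHS](_ : _ = m%:R * y ^+ 2); last by ring.
  by rewrite mulr_ge0// sqr_ge0.
by apply: ler_wpM2l => //; lra.
Qed.

(** On [[0, 1]], these polynomials in [v] tend to the indicator of [v < 1/2],
    except at [v = 1/2]. *)
Definition step_poly (n : nat) (v : R) : R := (1 - v ^+ n) ^+ (2 ^ n).

Lemma step_poly_bound n v : 0 <= v <= 1 -> 0 <= step_poly n v <= 1.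
Proof.
move=> /andP[v0 v1]; have vn0 : 0 <= v ^+ n by exact: exprn_ge0.
have vn1 : v ^+ n <= 1 by exact: exprn_ile1.
by rewrite exprn_ge0 ?exprn_ile1 ?subr_ge0// gerBl.
Qed.

(** Bernoulli's inequality gives (1 - v^n)^(2^n) >= 1 - (2v)^n, and 2v < 1. *)
Lemma cvg_step_poly1 v : 0 <= v -> v < 1 / 2 ->
  (fun n => step_poly n v) @ \oo --> (1 : R).
Proof.
move=> v0 v2; have v1 : v <= 1 by lra.
have c : (fun n => 1 - (2 * v) ^+ n) @ \oo --> (1 : R).
  rewrite -[X in _ --> X]subr0; apply: cvgB; first exact: cvg_cst.
  by apply: cvg_expr; rewrite ger0_norm ?mulr_ge0//; lra.
have H : \forall n \near \oo, 1 - (2 * v) ^+ n <= step_poly n v <= 1; last first.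
  exact: (squeeze_cvgr H c (cvg_cst _)).
apply: nearW => n.
have v01 : 0 <= v <= 1 by rewrite v0.
have /andP[_ ->] := step_poly_bound n v01; rewrite andbT.
have vn1 : v ^+ n <= 1 by exact: exprn_ile1.
have := @bernoulli_inequality (- v ^+ n) (2 ^ n).
by rewrite lerN2 => /(_ vn1); rewrite mulrN natrX -exprMn.
Qed.

(** Since (1 - v^n)(1 + v^n) <= 1, multiplying [step_poly n v] by (1 + v^n)^(2^n) gives at most 1,
    and Bernoulli bounds that factor below by (2v)^n, where 2v > 1. *)
Lemma cvg_step_poly0 v : 1 / 2 < v -> v <= 1 ->
  (fun n => step_poly n v) @ \oo --> (0 : R).
Proof.
move=> v2 v1; have v0 : 0 <= v by lra.
have c : (fun n => (2 * v)^-1 ^+ n) @ \oo --> (0 : R).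
  have v22 : 1 < 2 * v by lra.
  by apply: cvg_expr; rewrite ger0_norm ?invr_ge0 ?invf_lt1//; lra.
have H : \forall n \near \oo, 0 <= step_poly n v <= (2 * v)^-1 ^+ n; last first.
  exact: (squeeze_cvgr H (cvg_cst _) c).
apply: nearW => n.
have v01 : 0 <= v <= 1 by rewrite v0.
have /andP[s0 _] := step_poly_bound n v01; rewrite s0 /=.
have vn0 : 0 <= v ^+ n by exact: exprn_ge0.
have vn1 : v ^+ n <= 1 by exact: exprn_ile1.
have B : (2 * v) ^+ n <= (1 + v ^+ n) ^+ (2 ^ n).
  apply: le_trans (@bernoulli_inequality _ (2 ^ n) _); last by lra.
  by rewrite natrX -exprMn lerDr.
have p0 : 0 < (2 * v) ^+ n by rewrite exprn_gt0//; lra.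
rewrite exprVn -[leRHS]mul1r ler_pdivlMr//.
apply: (le_trans (ler_wpM2l s0 B)).
rewrite /step_poly -exprMn exprn_ile1//.
  by rewrite mulr_ge0//; lra.
rewrite -subr_ge0 [leRHS](_ : _ = (v ^+ n) ^+ 2); last by ring.
exact: sqr_ge0.
Qed.
End Exponential.

(** * Fourier modes on the torus and the closure of their span *)

Section TorusModes.
Variables (R : realType) (d : nat).
Local Notation T := (torus R d).
Local Notation mu := (torus_measure R d).
Implicit Types k l : d.-tuple int.

Definition mode k (x : T) : R[i] := expi (phase k x).

Lemma sqn_mode k x : sqn (mode k x) = 1.
Proof. exact: sqn_expi. Qed.

Lemma cmeasurable_expi (u : T -> R) : measurable_fun setT u ->
  cmeasurable (fun x => expi (u x)).
Proof.
move=> mu_; split; apply: measurableT_comp => //;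
  apply: continuous_measurable_fun; [exact: continuous_cos|exact: continuous_sin].
Qed.

Lemma cmeasurable_mode k : cmeasurable (mode k).
Proof. by apply: cmeasurable_expi; exact: measurable_phase. Qed.

Lemma square_integrable_mode k : square_integrable mu (mode k).
Proof.
apply: (@bounded_square_integrable _ _ _ _ 1); first exact: cmeasurable_mode.
by move=> x; rewrite sqn_mode.
Qed.

(** The integrand is a product of one-variable exponentials of frequencies k_j - l_j, so the
    integral factorises, and one coordinate with k_j <> l_j makes it vanish. *)
Lemma mode_dot k l :
  cdot mu (mode k) (mode l) = (k == l)%:R * ((2 * pi) ^+ d)%:C%C.
Proof.
pose u (j : 'I_d) (t : measurableTypeR R) : R[i] :=
  expi ((tnth k j - tnth l j)%:~R * t).
have uE : (fun x : T => mode k x * conjc (mode l x)) =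
    fun x : T => \prod_(j < d) u j (tnth x j).
  apply/funext => x; rewrite /mode conjc_expi -expiD /phase -sumrB expi_sum.
  by apply: eq_bigr => j _; rewrite /u rmorphB mulrBl.
rewrite /cdot uE (cintegral_power (fun j => (cintegral_expi R _).1)).2.
have [->|kl] := eqVneq k l.
  under eq_bigr do rewrite (cintegral_expi R _).2 subrr eqxx mul1r.
  by rewrite prodr_const card_ord mul1r rmorphXn.
have [j kj] : exists j, tnth k j != tnth l j.
  apply/existsP; apply: contraNT kl => /existsPn H; apply/eqP/eq_from_tnth => j.
  by have := H j; rewrite negbK => /eqP.
rewrite (bigD1 j)//= (cintegral_expi R _).2 subr_eq0 (negbTE kj).
by rewrite !mul0r.
Qed.

Lemma fourier_coef_cdot (f : T -> R[i]) k :
  fourier_coef f k = ((2 * pi) `^ (- (d%:R / 2)))%:C%C * cdot mu f (mode k).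
Proof.
rewrite /fourier_coef; congr (_ * cintegral _ _).
by apply/funext => x; rewrite /mode conjc_expi.
Qed.

(** The normalisation (2 pi)^(-d/2), once squared, is the inverse squared norm of a mode; so
    Parseval on the torus carries no constant. *)
Lemma sqn_fourier_coef (f : T -> R[i]) k :
  sqn (fourier_coef f k) = sqn (cdot mu f (mode k)) / (2 * pi) ^+ d.
Proof.
rewrite fourier_coef_cdot sqnM sqn_real mulrC; congr (_ * _).
rewrite -powR_mulrn ?powR_ge0// -powRrM mulNr divfK// powRN powR_mulrn//.
by rewrite mulr_ge0// pi_ge0.
Qed.

Definition add_freq k l : d.-tuple int := [tuple tnth k j + tnth l j | j < d].

Lemma mode_add k l x : mode (add_freq k l) x = mode k x * mode l x.
Proof.
rewrite /mode -expiD /phase -big_split /=; congr expi; apply: eq_bigr => j _.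
by rewrite tnth_mktuple rmorphD mulrDl.
Qed.

(** Frequencies may repeat in the list, which makes addition a concatenation and multiplication a
    list of all pairs. *)
Definition trig_poly (p : T -> R[i]) :=
  exists l : seq (R[i] * d.-tuple int), p = fun x => \sum_(t <- l) t.1 * mode t.2 x.

Lemma trig_polyZmode (c : R[i]) k : trig_poly (fun x => c * mode k x).
Proof. by exists [:: (c, k)]; apply/funext => x; rewrite big_seq1. Qed.

Lemma trig_poly_cst (c : R[i]) : trig_poly (fun=> c).
Proof.
exists [:: (c, [tuple 0 | _ < d])]; apply/funext => x.
rewrite big_seq1 /mode /phase big1 ?expi0 ?mulr1// => j _.
by rewrite tnth_mktuple mul0r.
Qed.

Lemma trig_polyD p q : trig_poly p -> trig_poly q -> trig_poly (p \+ q).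
Proof.
by move=> [s ->] [t ->]; exists (s ++ t); apply/funext => x; rewrite big_cat.
Qed.

Lemma trig_polyM p q : trig_poly p -> trig_poly q -> trig_poly (p \* q).
Proof.
move=> [s ->] [t ->].
exists [seq (a.1 * b.1, add_freq a.2 b.2) | a <- s, b <- t]; apply/funext => x.
rewrite big_allpairs_dep /= mulr_suml; apply: eq_bigr => a _.
rewrite mulr_sumr; apply: eq_bigr => b _.
by rewrite mode_add mulrACA.
Qed.

Lemma trig_polyX p n : trig_poly p -> trig_poly (fun x => p x ^+ n).
Proof.
move=> tp; elim: n => [|n ih].
  by under eq_fun do rewrite expr0; exact: trig_poly_cst.
by under eq_fun do rewrite exprS; exact: trig_polyM tp ih.
Qed.

Lemma trig_poly_meas p : trig_poly p -> cmeasurable p.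
Proof.
move=> [l ->]; have := @square_integrable_sum _ _ _ mu _ l fst (fun t => mode t.2).
by case=> // t; exact: square_integrable_mode.
Qed.

Lemma trig_poly_bounded p : trig_poly p ->
  exists2 K : R, 0 < K & forall x, sqn (p x) <= K.
Proof.
move=> [l ->]; elim: l => [|t l [K K0 ih]].
  by exists 1 => // x; rewrite big_nil sqn0.
exists (2 * sqn t.1 + 2 * K) => [|x].
  by rewrite ltr_wpDl ?mulr_ge0 ?mulr_gt0 ?sqn_ge0.
rewrite big_cons (le_trans (sqnD_le _ _))// lerD// ler_wpM2l//.
by rewrite sqnM sqn_mode mulr1.
Qed.

(** Euler's formula; the real shift [b] only enters the coefficients, so the frequencies stay
    integral. *)
Lemma trig_poly_cos (j : 'I_d) (b : R) :
  trig_poly (fun x => (cos (tnth x j - b))%:C%C).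
Proof.
pose k (c : int) : d.-tuple int := [tuple if i == j then c else 0 | i < d].
have pk c (x : T) : phase (k c) x = c%:~R * tnth x j.
  rewrite /phase (bigD1 j)//= big1 => [|i ij]; rewrite tnth_mktuple ?eqxx ?addr0//.
  by rewrite (negbTE ij) mul0r.
rewrite (_ : (fun x => _) = (fun x => (expi (- b) * (2^-1)%:C%C) * mode (k 1) x) \+
    (fun x => (expi b * (2^-1)%:C%C) * mode (k (-1)) x)).
  by apply: trig_polyD; exact: trig_polyZmode.
apply/funext => x /=; rewrite /mode !pk mul1r mulN1r /expi cosB !cosN !sinN.
by apply/eqP; rewrite eq_complex /=; apply/andP; split; apply/eqP; field.
Qed.

Local Notation clos_set := (L2closure_set mu trig_poly).

Lemma measurable_coordinate (j : 'I_d) (B : set (measurableTypeR R)) :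
  measurable B -> measurable [set x : T | B (tnth x j)].
Proof.
by move=> mB; rewrite -[X in measurable X]setTI; exact: (measurable_tnth j).
Qed.

Lemma ae_coordinate (j : 'I_d) (B : set (measurableTypeR R)) : measurable B ->
  circle_measure R B = 0%E -> {ae mu, forall x : T, ~ B (tnth x j)}.
Proof.
move=> mB B0; exists [set x : T | B (tnth x j)]; split.
- exact: measurable_coordinate.
- exact: power_measure_null.
- by move=> x /= /contrapT.
Qed.

Lemma ae_coordinate_neq (j : 'I_d) (a : R) : {ae mu, forall x : T, tnth x j <> a}.
Proof.
apply: (@ae_coordinate j [set a]); first exact: measurable_set1.
apply: circle_measure_null; first exact: measurable_set1.
apply: (@subset_measure0 _ _ _ (@lebesgue_measure R) _ [set a]) => //.
- by apply: measurableI => //; exact: measurable_itv.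
- exact: lebesgue_measure_set1.
Qed.

Lemma ae_coordinate_period (j : 'I_d) :
  {ae mu, forall x : T, 0 < tnth x j < 2 * pi}.
Proof.
have mI : measurable (~` `[0, 2 * pi] : set (measurableTypeR R)).
  by apply: measurableC; exact: measurable_itv.
have I0 : circle_measure R (~` `[0, 2 * pi]) = 0%E.
  by apply: circle_measure_null => //; rewrite setICl measure0.
apply: filterS3 (ae_coordinate j mI I0) (ae_coordinate_neq j 0)
  (ae_coordinate_neq j (2 * pi)) => x /contrapT.
rewrite /= in_itv /= => /andP[x0 x2] /eqP n0 /eqP n2.
by rewrite !lt_neqAle x0 x2 eq_sym n0 n2.
Qed.

Lemma cos_gt_arc (a t : R) : 0 < a -> a < 2 * pi -> 0 < t < a ->
  cos (a / 2) < cos (t - a / 2).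
Proof.
move=> a0 a2 /andP[t0 ta]; have pi0 := pi_gt0 R.
rewrite -(cos_norm (t - a / 2)).
have u0 := normr_ge0 (t - a / 2).
have ua : `|t - a / 2| < a / 2 by rewrite ltr_norml; apply/andP; split; lra.
by rewrite ltr_cos // in_itv /=; apply/andP; split; lra.
Qed.

Lemma cos_lt_arc (a t : R) : 0 < a -> a < 2 * pi -> a < t < 2 * pi ->
  cos (t - a / 2) < cos (a / 2).
Proof.
move=> a0 a2 /andP[t0 ta]; have pi0 := pi_gt0 R.
have [tp|tp] := leP (t - a / 2) pi.
  by rewrite ltr_cos ?in_itv /=; try (apply/andP; split); lra.
(* Beyond pi the cosine increases again. Reflection in pi brings the argument back to the decreasing
   branch, and it still exceeds a / 2 because t < 2 pi. *)
have -> : cos (t - a / 2) = cos (2 * pi - (t - a / 2)).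
  by rewrite -cosN -cosD2pi addrC mulr2n mulrDl mul1r.
by rewrite ltr_cos ?in_itv /=; try (apply/andP; split); lra.
Qed.

Lemma L2closure_set_ray (j : 'I_d) (a : R) :
  clos_set [set x : T | tnth x j < a].
Proof.
pose S := [set x : T | tnth x j < a]; rewrite -/S.
have mS : measurable S.
  apply: (@measurable_coordinate j [set t | t < a]).
  have -> : [set t : R | t < a] = `]-oo, a[%classic by rewrite set_itvE.
  exact: measurable_itv.
have mSc := @cmeasurable_cindic _ _ R _ mS.
have cc c : L2closure mu trig_poly (fun=> c).
  by apply: L2closure_sub; [exact: trig_poly_meas|exact: trig_poly_cst].
split => //; have [a0|a0] := leP a 0.
  apply: (ae_eq_L2closure trig_poly_meas mSc (cc 0)).
  apply: filterS (ae_coordinate_period j) => x /andP[x0 _].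
  by rewrite /cindic indicE memNset// /S /= => xa; have := lt_trans x0 xa; rewrite ltNge a0.
have [a2|a2] := leP (2 * pi) a.
  apply: (ae_eq_L2closure trig_poly_meas mSc (cc 1)).
  apply: filterS (ae_coordinate_period j) => x /andP[_ x2].
  by rewrite /cindic indicE mem_set// /S /=; exact: lt_le_trans a2.
(* The difference of cosines lies in [-2, 2], so dividing by 4 keeps [v] in [0, 1]; and v < 1/2
   exactly when cos(x_j - a/2) > cos(a/2). *)
pose v (x : T) := 1 / 2 + (cos (a / 2) - cos (tnth x j - a / 2)) / 4.
have v01 x : 0 <= v x <= 1.
  have := cos_geN1 (a / 2); have := cos_le1 (a / 2).
  have := cos_geN1 (tnth x j - a / 2); have := cos_le1 (tnth x j - a / 2).
  by rewrite /v => *; apply/andP; split; lra.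
pose f n (x : T) := (step_poly n (v x))%:C%C.
have tf n : trig_poly (f n).
  have tv : trig_poly (fun x => (v x)%:C%C).
    rewrite (_ : (fun x => _) = (fun=> (1 / 2 + cos (a / 2) / 4)%:C%C) \+
        ((fun=> (- 4^-1)%:C%C) \* (fun x => (cos (tnth x j - a / 2))%:C%C))).
      apply: trig_polyD; first exact: trig_poly_cst.
      by apply: trig_polyM; [exact: trig_poly_cst|exact: trig_poly_cos].
    apply/funext => x /=; rewrite -rmorphM -rmorphD; congr (_%:C)%C.
    by rewrite /v; field.
  rewrite (_ : f n = fun x => ((fun=> 1) \+ ((fun=> -1) \* (fun x => (v x)%:C%C ^+ n))) x ^+ (2 ^ n)).
    apply: trig_polyX; apply: trig_polyD; first exact: trig_poly_cst.
    by apply: trig_polyM; [exact: trig_poly_cst|exact: trig_polyX].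
  apply/funext => x; rewrite /f /step_poly /= mulN1r rmorphXn rmorphB rmorphXn.
  by rewrite rmorph1.
apply: (L2closure_lim trig_poly_meas mSc) => e e0.
have : (fun n => L2sq mu (cindic R S \- f n)) @ \oo --> 0%E.
  apply: (@L2sq_cvg0 _ _ _ _ _ _ (cst 4)) => //.
  - by move=> n; exact: trig_poly_meas.
  - exact: finite_measure_integrable_cst.
  - move=> n x; apply: le_trans (sqnD_le _ _) _; rewrite sqnN /f sqn_real.
    have /andP[s0 s1] := step_poly_bound n (v01 x).
    have s2 : step_poly n (v x) ^+ 2 <= 1 by exact: exprn_ile1.
    by have := cindic_le1 R S x; rewrite /cst; lra.
  (* At x_j = a one has v = 1/2, where the polynomials tend to 1/e; outside the period the cosine no
     longer tells the two sides of a apart. *)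
  apply: filterS2 (ae_coordinate_period j) (ae_coordinate_neq j a) => x /andP[x0 x2] xa.
  have step (c : R) : (fun n => step_poly n (v x)) @ \oo --> c -> cindic R S x = c%:C%C ->
      (fun n => sqn (cindic R S x - f n x)) @ \oo --> 0.
    move=> sc ->.
    rewrite (_ : (fun n => _) = fun n => (c - step_poly n (v x)) * (c - step_poly n (v x))).
      have z : (fun n => c - step_poly n (v x)) @ \oo --> (0 : R).
        by rewrite -(subrr c); apply: cvgB => //; exact: cvg_cst.
      have zz : (fun n => (c - step_poly n (v x)) * (c - step_poly n (v x))) @ \oo --> 0 * (0 : R).
        exact: cvgM.
      by rewrite mulr0 in zz.
    by apply/funext => n; rewrite -rmorphB sqn_real expr2.
  have /andP[v0 v1] := v01 x.
  have [xa'|ax|/esym//] := ltgtP (tnth x j) a.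
    apply: (step 1); last by rewrite /cindic indicE mem_set.
    apply: cvg_step_poly1 => //.
    have := @cos_gt_arc a (tnth x j) a0 a2; rewrite x0 xa' => /(_ isT).
    by rewrite /v; lra.
  apply: (step 0).
    apply: cvg_step_poly0 => //.
    have := @cos_lt_arc a (tnth x j) a0 a2; rewrite ax x2 => /(_ isT).
    by rewrite /v; lra.
  by rewrite /cindic indicE memNset// /S /=; apply/negP; rewrite -leNgt ltW.
move=> /(L2sq_cvg0_ex e0)[n ?]; exists (f n) => //.
by apply: L2closure_sub; [exact: trig_poly_meas|exact: tf].
Qed.

Lemma trig_closure_sigma_algebra : sigma_algebra setT clos_set.
Proof.
exact: (L2closure_set_sigma_algebra mu trig_poly_meas trig_poly_bounded
  trig_poly_cst trig_polyD trig_polyM).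
Qed.

(** Preimages under a coordinate commute with complements and countable unions, so the good sets [B]
    form a sigma-algebra, and rays generate the Borel sets of the line. *)
Lemma L2closure_set_coordinate (j : 'I_d) (B : set (measurableTypeR R)) :
  measurable B -> clos_set [set x : T | B (tnth x j)].
Proof.
have [s0 sC sU] := trig_closure_sigma_algebra.
rewrite [measurable](RGenInftyO.measurableE R).
apply: (@smallest_sub _ _ _ [set B : set R | clos_set [set x : T | B (tnth x j)]]).
  split => //=.
  - by move=> C cC; exact: (sC _ cC).
  - by move=> F cF; exact: (sU _ cF).
move=> _ [a ->] /=.
rewrite (_ : [set x | _] = [set x : T | tnth x j < a]); first exact: L2closure_set_ray.
by apply/seteqP; split => x /=; rewrite in_itv.
Qed.

Lemma trig_poly_dense : @measurable _ T `<=` clos_set.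
Proof.
apply: smallest_sub; first exact: trig_closure_sigma_algebra.
move=> C; rewrite -bigcup_seq => -[j _ [B mB <-]].
by rewrite setTI; exact: L2closure_set_coordinate.
Qed.

Theorem torus_parseval (f : T -> R[i]) : square_integrable mu f ->
  L2sq mu f = \esum_(k in [set: d.-tuple int]) (sqn (fourier_coef f k))%:E.
Proof.
move=> ff; rewrite (@parseval _ _ _ mu _ mode ((2 * pi) ^+ d))//.
- by apply: eq_esum => k _; rewrite sqn_fourier_coef.
- by rewrite exprn_gt0// mulr_gt0// pi_gt0.
- exact: square_integrable_mode.
- exact: mode_dot.
move=> g [mg gg] eps eps0.
have := L2closure_L2 (A := trig_poly) trig_poly_meas trig_poly_bounded
  trig_poly_cst trig_polyD trig_polyM trig_poly_dense mg gg.
by move=> [_ /(_ _ eps0)[p [l ->] lg]]; exists l.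
Qed.
End TorusModes.

(** * Two-sided bounds for the approximation numbers *)

Section L2Space.
Context d (T : measurableType d) (R : realType).
Variable mu : {finite_measure set T -> \bar R}.
Implicit Types f g : T -> R[i].

Lemma cL2normE f : cL2norm mu f = (L2sq mu f `^ 2^-1)%E.
Proof.
rewrite /cL2norm unlock /L2sq; congr (_ `^ _)%E; apply: eq_integral => x _.
rewrite /= -sqn_normc ger0_norm; last by case: (f x) => a b; exact: sqrtr_ge0.
by rewrite powR_mulrn//; case: (f x) => a b; exact: sqrtr_ge0.
Qed.

Lemma L2_predE f : (f \in L2_pred mu) <-> square_integrable mu f.
Proof.
split=> [/L2_predP[mf ff]|[mf ff]]; last first.
  by apply/L2_predP; split=> //; rewrite cL2normE poweR_lty.
by split=> //; move: ff; rewrite cL2normE => /lty_poweRy; apply; rewrite invr_neq0.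
Qed.

Lemma L2norm_sq (f : L2 mu) : ((L2norm f) ^+ 2)%:E = L2sq mu (repr f).
Proof.
have ff : square_integrable mu (repr f) by apply/L2_predE; exact: valP.
rewrite /L2norm cL2normE (L2sq_fin ff) /=; congr (_%:E).
by rewrite -powR_mulrn ?powR_ge0// -powRrM mulVf// powRr1// fine_ge0// L2sq_ge0.
Qed.

Lemma L2norm_ge0 (f : L2 mu) : 0 <= L2norm f.
Proof. by rewrite fine_ge0// cL2normE poweR_ge0. Qed.
End L2Space.

Lemma esum_finite_support (R : realType) (I : choiceType) (s : seq I) (u : I -> R) :
  uniq s -> (forall k, 0 <= u k) -> (forall k, k \notin s -> u k = 0) ->
  \esum_(k in [set: I]) (u k)%:E = (\sum_(k <- s) u k)%:E.
Proof.
move=> us u0 usupp.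
rewrite -sumEFin fsbig_seq//= -esum_fset; last 2 first.
- exact: finite_seq.
- by move=> i _; rewrite lee_fin.
rewrite [RHS]esum_mkcond; apply: eq_esum => k _.
by case: ifPn => // /negP ks; rewrite usupp//; apply/negP => h; apply: ks; rewrite inE.
Qed.

Section MixedSpaces.
Variables (R : realType) (d : nat) (s : R).
Local Notation T := (torus R d).
Local Notation mu := (torus_measure R d).
Local Notation freq := (d.-tuple int).
Implicit Types (f g : L2torus R d) (k : freq) (F : seq freq).

Lemma L2norm_coef f :
  ((L2norm f) ^+ 2)%:E = \esum_(k in [set: freq]) (sqn (L2coef f k))%:E.
Proof. by rewrite L2norm_sq torus_parseval//; apply/L2_predE; exact: valP. Qed.

Lemma mix_sumE f : mix_sum s f =
  \esum_(k in [set: freq]) (sqn (L2coef f k) * mix_weight s k)%:E.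
Proof. by apply: eq_esum => k _; rewrite sqn_normc. Qed.

Lemma mix_sum_ge0 f : (0 <= mix_sum s f)%E.
Proof.
by rewrite mix_sumE; apply: esum_ge0 => k _; rewrite lee_fin mulr_ge0 ?sqn_ge0 ?mix_weight_ge0.
Qed.

Lemma Hmix_norm_sq (x : Hmix d s) : ((Hmix_norm x) ^+ 2)%:E = mix_sum s (val x).
Proof.
have xs : (mix_sum s (val x) < +oo)%E := valP x.
rewrite /Hmix_norm sqr_sqrtr; last by rewrite fine_ge0// mix_sum_ge0.
by rewrite fineK// ge0_fin_numE// mix_sum_ge0.
Qed.

Lemma Hmix_norm_ge0 (x : Hmix d s) : 0 <= Hmix_norm x.
Proof. exact: sqrtr_ge0. Qed.

Lemma mix_weight_ge1 k : 1 <= mix_weight s k.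
Proof.
rewrite /mix_weight; elim/big_ind: _ => // [x y x1 y1|j _].
  by rewrite -[1]mulr1 ler_pM.
by rewrite lerDl powR_ge0.
Qed.

Lemma L2coef0 k : L2coef (0 : L2torus R d) k = 0.
Proof. by have := L2coef_lin (-1) (0 : L2torus R d) 0 k; rewrite scaler0 addr0 mulN1r addNr. Qed.

Lemma L2coefB f g k : L2coef (f - g) k = L2coef f k - L2coef g k.
Proof. by rewrite -scaleN1r addrC L2coef_lin mulN1r addrC. Qed.

Lemma L2coef_sum (J : Type) (l : seq J) (a : J -> R[i]) (u : J -> L2torus R d) k :
  L2coef (\sum_(j <- l) a j *: u j) k = \sum_(j <- l) a j * L2coef (u j) k.
Proof.
elim: l => [|j l ih]; first by rewrite !big_nil L2coef0.
by rewrite !big_cons L2coef_lin ih.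
Qed.

Lemma scaled_mode_L2 k :
  (fun x : T => ((2 * pi) `^ (- (d%:R / 2)))%:C%C * mode k x) \in L2_pred mu.
Proof. by apply/L2_predE; apply: square_integrableZ; exact: square_integrable_mode. Qed.

(** Normalised so that its Fourier coefficients are Kronecker deltas: the factor (2 pi)^(-d/2) here
    and the one in [fourier_coef] cancel the squared norm (2 pi)^d. *)
Definition basis k : L2torus R d := (\pi_(L2 mu) (MkL2fun (scaled_mode_L2 k)))%qT.

Lemma L2coef_basis k l : L2coef (basis k) l = (l == k)%:R.
Proof.
rewrite /L2coef (ae_eq_fourier_coef _ _ _ (repr_piP (MkL2fun (scaled_mode_L2 k))));
  [|exact: valP|exact: scaled_mode_L2].
rewrite fourier_coef_cdot.
have -> : (MkL2fun (scaled_mode_L2 k) : T -> R[i]) = fun x =>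
    \sum_(j <- [:: k]) ((2 * pi) `^ (- (d%:R / 2)))%:C%C * mode j x.
  by apply/funext => x; rewrite big_seq1.
rewrite cdot_suml; [|exact: square_integrable_mode..].
rewrite big_seq1 mode_dot eq_sym mulrA mulrC -mulrA -!rmorphM -[RHS]mulr1; congr (_ * _).
have p0 : (2 * pi : R) != 0 by rewrite gt_eqF// mulr_gt0// pi_gt0.
rewrite -powRD ?p0 ?implybT//.
rewrite -powR_mulrn ?mulr_ge0 ?pi_ge0// -powRD ?p0 ?implybT//.
rewrite [X in _ `^ X](_ : _ = 0) ?powRr0//.
by field.
Qed.

Definition lincomb F (a : freq -> R[i]) : L2torus R d := \sum_(k <- F) a k *: basis k.

Lemma L2coef_lincomb F a k : uniq F ->
  L2coef (lincomb F a) k = if k \in F then a k else 0.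
Proof.
move=> uF; rewrite L2coef_sum; case: ifPn => kF.
  rewrite (bigD1_seq k)//= L2coef_basis eqxx mulr1 big1 ?addr0// => l lk.
  by rewrite L2coef_basis eq_sym (negbTE lk) mulr0.
rewrite big_seq big1// => l lF; rewrite L2coef_basis.
by case: eqP => [kl|_]; rewrite ?mulr0//; rewrite kl lF in kF.
Qed.

Lemma mix_sum_lincomb F a : uniq F ->
  mix_sum s (lincomb F a) = (\sum_(k <- F) sqn (a k) * mix_weight s k)%:E.
Proof.
move=> uF; rewrite mix_sumE (esum_finite_support uF).
- congr (_%:E); apply: eq_big_seq => k kF.
  by rewrite L2coef_lincomb// kF.
- by move=> k; rewrite mulr_ge0 ?sqn_ge0 ?mix_weight_ge0.
- by move=> k kF; rewrite L2coef_lincomb// (negbTE kF) sqn0 mul0r.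
Qed.

Lemma L2norm_lincomb F a : uniq F ->
  (L2norm (lincomb F a)) ^+ 2 = \sum_(k <- F) sqn (a k).
Proof.
move=> uF; apply: EFin_inj; rewrite L2norm_coef (esum_finite_support uF).
- congr (_%:E); apply: eq_big_seq => k kF.
  by rewrite L2coef_lincomb// kF.
- by move=> k; rewrite sqn_ge0.
- by move=> k kF; rewrite L2coef_lincomb// (negbTE kF) sqn0.
Qed.

Lemma lincomb_Hmix F a : uniq F -> lincomb F a \in Hmix_pred s.
Proof. by move=> uF; rewrite unfold_in /Hmix_pred mix_sum_lincomb// ltry. Qed.

(** Orthogonal projection of L2 composed with the embedding: a competitor for the approximation
    numbers must start from the mixed space. *)
Definition freq_projection F (x : Hmix d s) : L2torus R d :=
  lincomb F (L2coef (val x)).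

Lemma freq_projection_linear F : linear (freq_projection F).
Proof.
move=> a x y; rewrite /freq_projection /lincomb scaler_sumr -big_split /=.
apply: eq_bigr => k _.
by rewrite (L2coef_lin a (val x) (val y)) scalerDl scalerA.
Qed.

HB.instance Definition _ F := GRing.isLinear.Build R[i] (Hmix d s) (L2torus R d) *:%R
  (freq_projection F) (freq_projection_linear F).

(** By Parseval it suffices to compare coefficients. With c = 1 this bounds the projections and the
    embedding, with c = 1/W the error of truncation. *)
Lemma L2norm_le_Hmix f (x : Hmix d s) (c : R) : 0 <= c ->
  (forall k, sqn (L2coef f k) <= c * (sqn (L2coef (val x) k) * mix_weight s k)) ->
  (L2norm f) ^+ 2 <= c * (Hmix_norm x) ^+ 2.
Proof.
move=> c0 H.
suff : (((L2norm f) ^+ 2)%:E <= c%:E * ((Hmix_norm x) ^+ 2)%:E)%E.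
  by rewrite -EFinM lee_fin.
rewrite L2norm_coef Hmix_norm_sq mix_sumE.
apply: le_trans (esum_le_scale c0 _).
  by apply: le_esum => k _; rewrite lee_fin.
by move=> k; rewrite mulr_ge0 ?sqn_ge0 ?mix_weight_ge0.
Qed.

Lemma freq_projection_bounded F : uniq F ->
  bounded_op (@Hmix_norm R d s) (@L2norm _ _ R mu) (freq_projection F).
Proof.
move=> uF; exists 1 => x; rewrite mul1r.
rewrite -(@ler_pXn2r _ 2)// ?nnegrE ?L2norm_ge0 ?Hmix_norm_ge0//.
rewrite -[leRHS]mul1r; apply: L2norm_le_Hmix => // k; rewrite mul1r L2coef_lincomb//.
case: ifPn => _; last by rewrite sqn0 mulr_ge0 ?sqn_ge0 ?mix_weight_ge0.
by rewrite ler_peMr ?sqn_ge0 ?mix_weight_ge1.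
Qed.

Lemma freq_projection_rank F : uniq F -> has_rank (freq_projection F) (size F).
Proof.
move=> uF; exists (fun i => basis (tnth (in_tuple F) i)).
have tF (i : 'I_(size F)) : tnth (in_tuple F) i \in F by exact: mem_tnth.
have coefT (a : 'I_(size F) -> R[i]) i :
    L2coef (\sum_j a j *: basis (tnth (in_tuple F) j)) (tnth (in_tuple F) i) = a i.
  rewrite L2coef_sum (bigD1 i)//= L2coef_basis eqxx mulr1 big1 ?addr0// => j ji.
  rewrite L2coef_basis.
  have tinj : injective (tnth (in_tuple F)) by apply/tuple_uniqP.
  by rewrite (inj_eq tinj) eq_sym (negbTE ji) mulr0.
split.
- move=> i; set k := tnth _ i.
  have u1 : uniq [:: k] by [].
  exists (MkHmix (lincomb_Hmix (fun=> 1) u1)).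
  rewrite /freq_projection /lincomb (bigD1_seq k) ?tF//=.
  rewrite -[X in L2coef X k]/(lincomb [:: k] (fun=> 1)) L2coef_lincomb// mem_seq1 eqxx scale1r.
  rewrite big1 ?addr0// => l lk.
  rewrite -[X in L2coef X l]/(lincomb [:: k] (fun=> 1)) L2coef_lincomb// mem_seq1.
  by rewrite (negbTE lk) scale0r.
- by move=> a a0 i; rewrite -(coefT a i) a0 L2coef0.
- move=> x; exists (fun i => L2coef (val x) (tnth (in_tuple F) i)).
  by rewrite /freq_projection /lincomb big_tnth.
Qed.

Lemma L2normB f g : (L2norm (f - g)) ^+ 2 <= 2 * (L2norm f) ^+ 2 + 2 * (L2norm g) ^+ 2.
Proof.
suff : (((L2norm (f - g)) ^+ 2)%:E <= 2%:E * ((L2norm f) ^+ 2)%:E + 2%:E * ((L2norm g) ^+ 2)%:E)%E.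
  by rewrite -!EFinM -EFinD lee_fin.
rewrite !L2norm_coef.
have s0 (h : L2torus R d) k : (0 <= (sqn (L2coef h k))%:E)%E by rewrite lee_fin sqn_ge0.
apply: (@le_trans _ _ (\esum_(k in [set: freq]) (2 * sqn (L2coef f k))%:E +
    \esum_(k in [set: freq]) (2 * sqn (L2coef g k))%:E)%E).
  rewrite -esumD; try by (move=> k _; rewrite lee_fin mulr_ge0 ?sqn_ge0).
  apply: le_esum => k _; rewrite -EFinD lee_fin L2coefB.
  by apply: le_trans (sqnD_le _ _) _; rewrite sqnN.
by apply: leeD; apply: esum_le_scale => // k; exact: sqn_ge0.
Qed.

Local Notation a_ := (approx_number (@Hmix_norm R d s) (@L2norm _ _ R mu) (Hmix_embedding d s)).
Local Notation op_norm := (op_norm (@Hmix_norm R d s) (@L2norm _ _ R mu)).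

Lemma Hmix_norm0 : Hmix_norm (0 : Hmix d s) = 0.
Proof.
rewrite /Hmix_norm mix_sumE esum1 ?sqrtr0// => k _.
by rewrite -[X in L2coef X k]/(0 : L2torus R d) L2coef0 sqn0 mul0r.
Qed.

Lemma L2norm0 : L2norm (0 : L2torus R d) = 0.
Proof.
apply/eqP; rewrite -sqrf_eq0; apply/eqP/EFin_inj.
by rewrite L2norm_coef esum1// => k _; rewrite L2coef0 sqn0.
Qed.

Lemma op_norm_ge0 (B : Hmix d s -> L2torus R d) : B 0 = 0 -> 0 <= op_norm B.
Proof.
move=> B0; rewrite /Defs.op_norm; set S := [set _ | _ in _].
have S0 : S 0 by exists 0; rewrite /= ?Hmix_norm0// B0 L2norm0.
(* The supremum of an unbounded set is 0 by convention, which satisfies the bound too. *)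
have [hs|/sup_out ->//] := pselect (has_sup S).
exact: (ub_le_sup hs.2 S0).
Qed.

Lemma op_norm_le (B : Hmix d s -> L2torus R d) (c : R) : 0 <= c ->
  (forall x, (L2norm (B x)) ^+ 2 <= c ^+ 2 * (Hmix_norm x) ^+ 2) -> op_norm B <= c.
Proof.
move=> c0 H; apply: ge_sup.
  by exists (L2norm (B 0)); exists 0; rewrite /= ?Hmix_norm0.
move=> _ [x /= x1 <-].
rewrite -(@ler_pXn2r _ 2)// ?nnegrE ?L2norm_ge0//; apply: le_trans (H x) _.
rewrite -[leRHS]mulr1; apply: ler_wpM2l; first exact: sqr_ge0.
by rewrite exprn_ile1// Hmix_norm_ge0.
Qed.

(** Boundedness guarantees that [sup] is a true supremum and not its default value 0. *)
Lemma op_norm_ge (B : Hmix d s -> L2torus R d) x :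
  bounded_op (@Hmix_norm R d s) (@L2norm _ _ R mu) B ->
  Hmix_norm x <= 1 -> L2norm (B x) <= op_norm B.
Proof.
move=> [M BM] x1; apply: ub_le_sup; last by exists x.
exists `|M| => _ [y /= y1 <-]; apply: le_trans (BM y) _.
apply: (le_trans (ler_norm _)); rewrite normrM [X in _ * X]ger0_norm ?Hmix_norm_ge0//.
by rewrite -[leRHS]mulr1; apply: ler_wpM2l.
Qed.

Lemma embedding_residual_bounded (A : {linear Hmix d s -> L2torus R d}) :
  bounded_op (@Hmix_norm R d s) (@L2norm _ _ R mu) A ->
  bounded_op (@Hmix_norm R d s) (@L2norm _ _ R mu) (fun x => Hmix_embedding d s x - A x).
Proof.
move=> [M AM]; exists (Num.sqrt (2 + 2 * M ^+ 2)) => x.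
have M2 : 0 <= 2 + 2 * M ^+ 2 by rewrite addr_ge0// mulr_ge0// sqr_ge0.
rewrite -(@ler_pXn2r _ 2)// ?nnegrE ?L2norm_ge0//; last first.
  by rewrite mulr_ge0 ?sqrtr_ge0 ?Hmix_norm_ge0.
rewrite exprMn sqr_sqrtr//; apply: le_trans (L2normB _ _) _.
rewrite [leRHS](_ : _ = 2 * Hmix_norm x ^+ 2 + 2 * M ^+ 2 * Hmix_norm x ^+ 2); last by ring.
apply: lerD.
  apply: ler_wpM2l => //; rewrite -[leRHS]mul1r; apply: L2norm_le_Hmix => // k.
  by rewrite mul1r ler_peMr ?sqn_ge0 ?mix_weight_ge1.
rewrite -mulrA; apply: ler_wpM2l => //; rewrite -exprMn.
by rewrite lerXn2r ?nnegrE ?L2norm_ge0// (le_trans _ (AM x))// L2norm_ge0.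
Qed.

Lemma approx_number_has_lbound n : has_lbound [set r | exists A : {linear Hmix d s -> L2torus R d},
    [/\ bounded_op (@Hmix_norm R d s) (@L2norm _ _ R mu) A, rank_lt A n &
        r = op_norm (fun x => Hmix_embedding d s x - A x)]].
Proof.
exists 0 => _ [A [_ _ ->]]; apply: op_norm_ge0.
by rewrite (linear0 A) subr0; exact: (linear0 (Hmix_embedding d s)).
Qed.

Lemma approx_number_le F n (W : R) : uniq F -> (size F < n)%N -> 0 < W ->
  (forall k, k \notin F -> W <= mix_weight s k) -> a_ n <= (Num.sqrt W)^-1.
Proof.
move=> uF Fn W0 HW.
apply: (@le_trans _ _ (op_norm (fun x => Hmix_embedding d s x - freq_projection F x))).
  apply: (ge_inf (approx_number_has_lbound n)).
  exists (freq_projection F); split => //.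
  - exact: freq_projection_bounded.
  - by exists (size F) => //; exact: freq_projection_rank.
apply: op_norm_le; first by rewrite invr_ge0 sqrtr_ge0.
move=> x; rewrite exprVn sqr_sqrtr; last exact: ltW.
apply: (@L2norm_le_Hmix _ x W^-1).
  by rewrite invr_ge0 ltW.
move=> k; rewrite L2coefB L2coef_lincomb//; case: ifPn => kF.
  by rewrite subrr sqn0 !mulr_ge0 ?invr_ge0 ?sqn_ge0 ?mix_weight_ge0// ltW.
rewrite subr0 mulrC -mulrA; apply: ler_peMr; first exact: sqn_ge0.
by rewrite ler_pdivlMr// mul1r; exact: HW.
Qed.

(** Row [i] of the matrix [K] holds the coordinates in [b] of the image of the [i]-th mode of [F].
    There are more rows than columns, so a nonzero row vector [v] satisfies v K = 0. A nonzero
    coefficient is returned as the witness that the vector is nonzero. *)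
Lemma rank_lt_kernel F n (A : {linear Hmix d s -> L2torus R d}) : uniq F ->
  (n <= size F)%N -> rank_lt A n ->
  exists2 x : Hmix d s, A x = 0 & exists2 a, val x = lincomb F a & exists2 k, k \in F & a k != 0.
Proof.
move=> uF nF [m mn [b [_ _ bA]]]; pose N := size F.
have uk (i : 'I_N) : uniq [:: tnth (in_tuple F) i] by [].
pose xb (i : 'I_N) := MkHmix (lincomb_Hmix (fun=> 1) (uk i)).
have vxb i : val (xb i) = basis (tnth (in_tuple F) i).
  by rewrite /= /lincomb big_seq1 scale1r.
have /choice[M HM] i := bA (xb i).
pose K := \matrix_(i < N, j < m) M i j.
have : kermx K != 0.
  rewrite -mxrank_eq0 mxrank_ker subn_eq0 -ltnNge.
  by rewrite (leq_ltn_trans (rank_leq_col K))// (leq_trans mn nF).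
move=> /rowV0Pn[v /sub_kermxP vK v0].
have tinj : injective (tnth (in_tuple F)) by apply/tuple_uniqP.
exists (\sum_i v 0 i *: xb i).
  rewrite linear_sum /=; under eq_bigr do rewrite linearZ_LR HM scaler_sumr.
  rewrite exchange_big /= big1// => j _.
  under eq_bigr do rewrite scalerA.
  rewrite -scaler_suml [X in X *: _](_ : _ = (v *m K) 0 j); last first.
    by rewrite mxE; apply: eq_bigr => i _; rewrite mxE.
  by rewrite vK mxE scale0r.
(* [v] is indexed by positions in [F] and [lincomb] by frequencies; without repetitions in [F], the
   sum has a single term at each frequency of [F]. *)
pose a k := \sum_(i < N | tnth (in_tuple F) i == k) v 0 i.
have aE i : a (tnth (in_tuple F) i) = v 0 i.
  rewrite /a (bigD1 i)//= big1 ?addr0// => j /andP[/eqP/tinj -> /eqP].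
  by [].
exists a.
  transitivity (\sum_(i < N) v 0 i *: basis (tnth (in_tuple F) i)).
    rewrite -[LHS]/(Hmix_embedding d s (\sum_i v 0 i *: xb i)) linear_sum.
    by apply: eq_bigr => i _; rewrite linearZ_LR -vxb.
  by rewrite /lincomb [RHS]big_tnth; apply: eq_bigr => i _; rewrite aE.
have [i vi] : exists i, v 0 i != 0.
  apply/existsP; apply: contraNT v0 => /existsPn H; apply/eqP/rowP => i.
  by have := H i; rewrite negbK mxE => /eqP.
by exists (tnth (in_tuple F) i); [exact: mem_tnth|rewrite aE].
Qed.

(** On the span of the modes in [F] the squared mixed norm is at most [W] times the squared L2 norm.
    Any competitor kills a nonzero vector there, so on it the error is the whole embedding. *)
Lemma approx_number_ge F n (W : R) : uniq F -> (0 < n <= size F)%N -> 0 < W ->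
  (forall k, k \in F -> mix_weight s k <= W) -> (Num.sqrt W)^-1 <= a_ n.
Proof.
move=> uF /andP[n0 nF] W0 HW; apply: lb_le_inf.
  (* The zero operator has rank 0 < n, so the infimum is over a nonempty set; on the empty set it
     would be 0 by convention. *)
  exists (op_norm (fun x => Hmix_embedding d s x - freq_projection [::] x)).
  exists (freq_projection [::]); split => //.
  - exact: freq_projection_bounded.
  - by exists 0%N => //; exact: freq_projection_rank.
move=> _ [A [bA rA ->]].
have [x Ax [a xa [k kF ak]]] := rank_lt_kernel uF nF rA.
pose S := \sum_(k <- F) sqn (a k).
have S0 : 0 < S.
  rewrite /S (bigD1_seq k)//= ltr_pwDl ?sumr_ge0// => [|l _]; last exact: sqn_ge0.
  by rewrite lt0r sqn_ge0 andbT; apply: contra_neq ak; exact: sqn_eq0.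
(* [S] is the squared L2 norm of [x]. After scaling by [c], the squared L2 norm is exactly 1/W and
   the mixed norm is at most 1. *)
pose c := (Num.sqrt (W * S))^-1; have WS0 : 0 < W * S by rewrite mulr_gt0.
pose y := c%:C%C *: x.
have ya : val y = lincomb F (fun k => c%:C%C * a k).
  rewrite [LHS](_ : _ = c%:C%C *: val x)// xa /lincomb scaler_sumr.
  by apply: eq_bigr => l _; rewrite scalerA.
have cS l : sqn (c%:C%C * a l) = c ^+ 2 * sqn (a l) by rewrite sqnM sqn_real.
have c2 : c ^+ 2 = (W * S)^-1 by rewrite exprVn sqr_sqrtr// ltW.
have y1 : Hmix_norm y <= 1.
  rewrite -(@ler_pXn2r _ 2)// ?nnegrE ?Hmix_norm_ge0// expr1n -lee_fin Hmix_norm_sq ya.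
  rewrite mix_sum_lincomb// lee_fin.
  apply: (@le_trans _ _ (\sum_(k <- F) c ^+ 2 * sqn (a k) * W)).
    rewrite big_seq [leRHS]big_seq; apply: ler_sum => l lF; rewrite cS.
    by rewrite ler_wpM2l ?HW// mulr_ge0 ?sqr_ge0 ?sqn_ge0.
  by rewrite -mulr_suml -mulr_sumr -/S c2 -mulrA [S * W]mulrC mulVf ?gt_eqF.
apply: le_trans (op_norm_ge (embedding_residual_bounded bA) y1).
rewrite (_ : A y = 0) ?subr0; last by rewrite linearZ_LR Ax scaler0.
rewrite -(@ler_pXn2r _ 2)// ?nnegrE ?L2norm_ge0 ?invr_ge0 ?sqrtr_ge0//.
rewrite -[X in L2norm X]/(val y) ya L2norm_lincomb// exprVn sqr_sqrtr; last exact: ltW.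
under eq_bigr do rewrite cS.
by rewrite -mulr_sumr -/S c2 invfM -mulrA mulVf ?mulr1// gt_eqF.
Qed.
End MixedSpaces.

(** * Hyperbolic crosses *)

Section HyperbolicCross.
Context {R : realType}.
Implicit Types (M N d p : nat) (r : R).

(** The integers with M <= |m| <= N, laid out as zero and two signed copies so that even sums double
    the positive part; [maxn M 1] keeps zero from being listed again. *)
Definition intseg M N : seq int :=
  (if M == 0%N then [:: 0] else [::]) ++
  ([seq n%:Z | n <- index_iota (maxn M 1) N.+1] ++
   [seq - n%:Z | n <- index_iota (maxn M 1) N.+1]).

Lemma mem_intseg M N (m : int) : (m \in intseg M N) = (M <= `|m| <= N)%N.
Proof.
rewrite /intseg !mem_cat; case: m => m.
  rewrite [X in _ || (X || _)](_ : _ = (maxn M 1 <= m <= N)%N); last first.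
    by rewrite mem_map ?mem_index_iota// => x y [].
  rewrite [X in _ || (_ || X)](_ : _ = false) ?orbF; last first.
    apply/negbTE/mapP => -[x]; rewrite mem_index_iota => /andP[x0 _] mx; lia.
  case: eqP => [->|M0]; rewrite /= ?in_nil ?mem_seq1; case: m => [|m]; rewrite /=; lia.
rewrite [X in _ || (X || _)](_ : _ = false) /=; last first.
  by apply/negbTE/mapP => -[x _].
rewrite [X in _ || X](_ : _ = (maxn M 1 <= m.+1 <= N)%N); last first.
  rewrite -[Negz m]/((fun n : nat => - n%:Z) m.+1) mem_map ?mem_index_iota// => x y.
  by move/oppr_inj => -[].
case: eqP => [->|M0]; rewrite /= ?in_nil ?mem_seq1 /=; lia.
Qed.

Lemma uniq_intseg M N : uniq (intseg M N).
Proof.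
have h (f : nat -> int) : injective f -> uniq [seq f n | n <- index_iota (maxn M 1) N.+1].
  by move=> fi; rewrite map_inj_uniq// iota_uniq.
rewrite /intseg cat_uniq cat_uniq !h => [|x y /oppr_inj[]//|x y []//].
rewrite /= andbT; apply/and3P; split; first by case: eqP.
  apply/negP => /hasP[x]; rewrite mem_cat => /orP[] /mapP[n];
    rewrite mem_index_iota => /andP[n0 _] ->; case: eqP => // _; rewrite mem_seq1; lia.
apply/negP => /hasP[x /mapP[n]]; rewrite mem_index_iota => /andP[n0 _] -> /mapP[m].
rewrite mem_index_iota; lia.
Qed.

Definition absz1 (m : int) : R := (maxn 1 `|m|)%:R.

Lemma absz1_ge1 m : 1 <= absz1 m.
Proof. by rewrite /absz1 (ler_nat R 1) leq_maxl. Qed.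

Lemma absz1_gt0 m : 0 < absz1 m.
Proof. exact: lt_le_trans (absz1_ge1 m). Qed.

(** Built by slicing along the first coordinate, so that [cross_sizeS] can be read off;
    [mem_hyperbolic_cross] recovers the product form. Stopping at the integer part of [r] loses
    nothing, the other factors being at least 1. *)
Fixpoint hyperbolic_cross M d r : seq (d.-tuple int) :=
  match d with
  | 0 => if 1 <= r then [:: [tuple]] else [::]
  | d'.+1 => [seq [tuple of m :: t] | m : int <- intseg M (Num.truncn r),
                                      t : d'.-tuple int <- hyperbolic_cross M d' (r / absz1 m)]
  end.

Lemma prod_absz1_ge1 d (k : d.-tuple int) : 1 <= \prod_(j < d) absz1 (tnth k j).
Proof.
elim/big_ind: _ => // [x y x1 y1|j _]; last exact: absz1_ge1.
by rewrite -[1]mulr1 ler_pM.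
Qed.

Lemma prod_absz1_cons d (m : int) (t : d.-tuple int) :
  \prod_(j < d.+1) absz1 (tnth [tuple of m :: t] j) =
  absz1 m * \prod_(j < d) absz1 (tnth t j).
Proof. by rewrite big_ord_recl tnth0; congr (_ * _); apply: eq_bigr => j _; rewrite tnthS. Qed.

Lemma mem_hyperbolic_cross M d r (k : d.-tuple int) :
  (k \in hyperbolic_cross M d r) =
  [forall j, (M <= `|tnth k j|)%N] && (\prod_(j < d) absz1 (tnth k j) <= r).
Proof.
elim: d r k => [|d ih] r k.
  rewrite big_ord0 tuple0 /=; case: ifP => r1; last by rewrite andbF.
  by rewrite mem_seq1 eqxx andbT; apply/esym/forallP => -[].
case/tupleP: k => m t; rewrite prod_absz1_cons /=.
have m0 := absz1_gt0 m; have t1 := prod_absz1_ge1 t.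
apply/allpairsPdep/andP.
  move=> [m' [t' [mI tI E]]].
  have [Em Et] : m = m' /\ t = t'.
    split; first by have := congr1 (fun u => tnth u ord0) E; rewrite !tnth0.
    apply: eq_from_tnth => j.
    by have := congr1 (fun u => tnth u (lift ord0 j)) E; rewrite !tnthS.
  subst m' t'; move: mI tI; rewrite mem_intseg ih => /andP[Mm _] /andP[/forallP Ht tr].
  split; last by rewrite mulrC -ler_pdivlMr.
  apply/forallP => j; case: (unliftP ord0 j) => [i|] ->; first by rewrite tnthS.
  by rewrite tnth0.
move=> [/forallP H mr]; exists m, t; split => //.
  rewrite mem_intseg; have := H ord0; rewrite tnth0 => -> /=.
  have mr' : absz1 m <= r.
    by apply: le_trans mr; rewrite ler_peMr// ltW.
  rewrite truncn_ge_nat; last by rewrite (le_trans _ mr')// ltW.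
  by apply: le_trans mr'; rewrite /absz1 ler_nat leq_maxr.
rewrite ih; apply/andP; split.
  by apply/forallP => j; have := H (lift ord0 j); rewrite tnthS.
by rewrite ler_pdivlMr// mulrC.
Qed.

Lemma uniq_hyperbolic_cross M d r : uniq (hyperbolic_cross M d r).
Proof.
elim: d r => [|d ih] r /=; first by case: ifP.
apply: allpairs_uniq_dep; [exact: uniq_intseg|by move=> m _; exact: ih|].
move=> [m t] [m' t'] _ _ /= E.
have [Em Et] : m = m' /\ t = t'.
  split; first by have := congr1 (fun u => tnth u ord0) E; rewrite !tnth0.
  apply: eq_from_tnth => j.
  by have := congr1 (fun u => tnth u (lift ord0 j)) E; rewrite !tnthS.
by subst.
Qed.

Definition cross_size M d r : R := (size (hyperbolic_cross M d r))%:R.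

Lemma cross_size_ge0 M d r : 0 <= cross_size M d r.
Proof. exact: ler0n. Qed.

Lemma cross_sizeS M d r : cross_size M d.+1 r =
  (if M == 0%N then cross_size M d r else 0) +
  2 * \sum_(maxn M 1 <= m < (Num.truncn r).+1) cross_size M d (r / m%:R).
Proof.
rewrite /cross_size /= size_allpairs_dep sumnE big_map natr_sum /intseg.
rewrite !big_cat /= !big_map; congr (_ + _).
  case: eqP => _; last by rewrite big_nil.
  by rewrite big_seq1 /absz1 /= divr1.
have E (m : nat) : m \in index_iota (maxn M 1) (Num.truncn r).+1 -> maxn 1 m = m.
  rewrite mem_index_iota; lia.
rewrite mulr2n mulrDl !mul1r; congr (_ + _); apply: eq_big_seq => m mI.
  by rewrite /absz1 /= E.
by rewrite /absz1 abszN /= E.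
Qed.

Lemma cross_size1 M r : 0 <= r -> cross_size M 1 r =
  (if M == 0%N then (1 <= r)%R%:R else 0) +
  2 * ((Num.truncn r).+1 - maxn M 1)%:R.
Proof.
move=> r0; rewrite cross_sizeS; congr (_ + 2 * _).
  by case: eqP => // _; rewrite /cross_size /=; case: ifP.
rewrite (eq_big_nat _ _ (F2 := fun=> 1)) ?sumr_const_nat// => m /andP[m0 mr].
rewrite /cross_size /= ler_pdivlMr ?mul1r; last by rewrite ltr0n; lia.
have -> : m%:R <= r by rewrite -truncn_ge_nat//; lia.
by [].
Qed.
End HyperbolicCross.

(** * Sums of powers of logarithms, by comparison with telescoping sums *)

Section LogarithmicSums.
Context {R : realType}.
Implicit Types (x y X L r : R) (p n N M : nat).

(** Together with [subX_le], an algebraic mean value theorem: the increment of x^(p+1) lies between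
    its derivatives at the two ends times the step. *)
Lemma subX_ge x y p : 0 <= y -> y <= x ->
  p.+1%:R * y ^+ p * (x - y) <= x ^+ p.+1 - y ^+ p.+1.
Proof.
move=> y0 yx; have x0 := le_trans y0 yx.
elim: p => [|p ih]; first by rewrite !expr1 expr0 !mul1r.
have -> : x ^+ p.+2 - y ^+ p.+2 = x * (x ^+ p.+1 - y ^+ p.+1) + y ^+ p.+1 * (x - y).
  by rewrite (exprS x p.+1) (exprS y p.+1); ring.
have -> : p.+2%:R * y ^+ p.+1 * (x - y) =
    y * (p.+1%:R * y ^+ p * (x - y)) + y ^+ p.+1 * (x - y).
  by rewrite -(@natr1 R p.+1) exprS; ring.
rewrite lerD2r; apply: ler_pM => //.
by rewrite !mulr_ge0 ?exprn_ge0 ?subr_ge0.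
Qed.

Lemma subX_le x y p : 0 <= y -> y <= x ->
  x ^+ p.+1 - y ^+ p.+1 <= p.+1%:R * x ^+ p * (x - y).
Proof.
move=> y0 yx; have x0 := le_trans y0 yx.
elim: p => [|p ih]; first by rewrite !expr1 expr0 !mul1r.
have -> : x ^+ p.+2 - y ^+ p.+2 = x * (x ^+ p.+1 - y ^+ p.+1) + y ^+ p.+1 * (x - y).
  by rewrite (exprS x p.+1) (exprS y p.+1); ring.
have -> : p.+2%:R * x ^+ p.+1 * (x - y) =
    x * (p.+1%:R * x ^+ p * (x - y)) + x ^+ p.+1 * (x - y).
  by rewrite -(@natr1 R p.+1) exprS; ring.
apply: lerD; first exact: ler_wpM2l.
by rewrite ler_wpM2r ?subr_ge0// lerXn2r.
Qed.

Lemma lnS_sub_le n : (0 < n)%N -> ln n.+1%:R - ln n%:R <= n%:R^-1 :> R.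
Proof.
move=> n0; have nR : 0 < n%:R :> R by rewrite ltr0n.
rewrite -ln_div ?posrE ?ltr0n//.
have -> : n.+1%:R / n%:R = 1 + n%:R^-1 :> R by rewrite -natr1 mulrDl divff ?gt_eqF// mul1r.
by apply: le_ln1Dx; rewrite (lt_trans (ltrN10 R))// invr_gt0.
Qed.

(** ln(1 + x) <= x at x = -1/(n+1), where 1 + x = n/(n+1), with signs reversed. *)
Lemma lnS_sub_ge n : (0 < n)%N -> n.+1%:R^-1 <= ln n.+1%:R - ln n%:R :> R.
Proof.
move=> n0; have nR : 0 < n%:R :> R by rewrite ltr0n.
rewrite -lerN2 opprB -ln_div ?posrE ?ltr0n//.
have -> : n%:R / n.+1%:R = 1 + - n.+1%:R^-1 :> R.
  by rewrite -[n%:R](addrK 1) natr1 mulrBl divff ?pnatr_eq0// mul1r.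
by apply: le_ln1Dx; rewrite ltrN2 invf_lt1 ?ltr0n// ltr1n.
Qed.

(** For m >= 2 a term is at most the drop of (X - ln)^(p+1) / (p+1) from m - 1 to m. The term m = 1
    has no predecessor and accounts for X^p. The sharper [H] keeps the last remainder, as the
    induction requires. *)
Lemma sum_ln_le X p N : (0 < N)%N -> ln N%:R <= X ->
  \sum_(1 <= m < N.+1) (X - ln m%:R) ^+ p / m%:R <= X ^+ p + X ^+ p.+1 / p.+1%:R.
Proof.
move=> N0 NX.
suff H : \sum_(1 <= m < N.+1) (X - ln m%:R) ^+ p / m%:R <=
    X ^+ p + (X ^+ p.+1 - (X - ln N%:R) ^+ p.+1) / p.+1%:R.
  apply: le_trans H _; rewrite lerD2l ler_pM2r ?invr_gt0 ?ltr0n// gerBl.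
  by rewrite exprn_ge0// subr_ge0.
elim: N N0 NX => // -[|N] ih _ NX.
  by rewrite big_nat1 ln1 subr0 subrr mul0r addr0 divr1.
have lnle : ln N.+1%:R <= ln N.+2%:R :> R by rewrite ler_ln ?posrE ?ltr0n// ler_nat.
rewrite big_nat_recr//=; apply: le_trans (lerD (ih _ _) (lexx _)) _ => //.
  exact: le_trans NX.
rewrite -addrA lerD2l -subr_ge0.
rewrite [leRHS](_ : _ = ((X - ln N.+1%:R) ^+ p.+1 - (X - ln N.+2%:R) ^+ p.+1) / p.+1%:R
    - (X - ln N.+2%:R) ^+ p / N.+2%:R); last by ring.
rewrite subr_ge0 ler_pdivlMr ?ltr0n//.
apply: le_trans (subX_ge _ _ _); rewrite ?subr_ge0 ?lerD2l ?lerN2//.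
rewrite [leLHS](_ : _ = p.+1%:R * (X - ln N.+2%:R) ^+ p * N.+2%:R^-1); last by ring.
apply: ler_wpM2l; first by rewrite mulr_ge0 ?exprn_ge0 ?subr_ge0.
by rewrite [leRHS](_ : _ = ln N.+2%:R - ln N.+1%:R) ?lnS_sub_ge//; ring.
Qed.

(** Each term dominates the drop of the positive part to the power p + 1 from m to m + 1. Truncating
    at 0 keeps the powers monotone past ln m = X and makes the telescoped end value vanish. *)
Lemma sum_ln_ge X p M N : (0 < M)%N -> (M <= N.+1)%N -> X <= ln N.+1%:R ->
  Num.max (X - ln M%:R) 0 ^+ p.+1 / p.+1%:R <=
  \sum_(M <= m < N.+1) Num.max (X - ln m%:R) 0 ^+ p / m%:R.
Proof.
move=> M0 MN XN.
pose G m := Num.max (X - ln m%:R) 0 ^+ p.+1.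
have GN : G N.+1 = 0 by rewrite /G max_r ?subr_le0// expr0n.
have -> : Num.max (X - ln M%:R) 0 ^+ p.+1 / p.+1%:R =
    \sum_(M <= m < N.+1) (G m - G m.+1) / p.+1%:R.
  rewrite -mulr_suml; congr (_ / _).
  rewrite -[RHS]opprK -sumrN; under eq_bigr do rewrite opprB.
  by rewrite telescope_sumr// GN sub0r opprK.
rewrite big_nat [leRHS]big_nat; apply: ler_sum => m /andP[Mm mN].
have m0 : (0 < m)%N by exact: leq_trans Mm.
rewrite ler_pdivrMr ?ltr0n//.
have lnle : ln m%:R <= ln m.+1%:R :> R by rewrite ler_ln ?posrE ?ltr0n// ler_nat.
have y0 z : 0 <= Num.max z 0 :> R by rewrite le_max lexx orbT.
have yx : Num.max (X - ln m.+1%:R) 0 <= Num.max (X - ln m%:R) 0.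
  by rewrite ge_max !le_max lexx orbT andbT lerD2l lerN2 lnle.
apply: le_trans (subX_le _ (y0 _) yx) _.
rewrite [leRHS](_ : _ = p.+1%:R * Num.max (X - ln m%:R) 0 ^+ p * m%:R^-1); last by ring.
apply: ler_wpM2l; first by rewrite mulr_ge0// exprn_ge0.
have := lnS_sub_le m0; move: lnle.
move: (ln m%:R) (ln m.+1%:R) (m%:R^-1) => a b c ab bac.
by rewrite /Num.max; case: ltP => h1; case: ltP => h2; lra.
Qed.
End LogarithmicSums.

(** * Cardinality of hyperbolic crosses *)

Section CrossSizeAsymptotics.
Context {R : realType}.
Implicit Types (p N M : nat) (r : R).

(** The limit constant in dimension p + 1, before raising to the power [s]. *)
Definition cross_const p : R := 2 ^+ p.+1 / p`!%:R.

Lemma cross_const_gt0 p : 0 < cross_const p.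
Proof. by rewrite divr_gt0 ?exprn_gt0// ltr0n fact_gt0. Qed.

Lemma cross_constS p : cross_const p.+1 = 2 * cross_const p / p.+1%:R.
Proof.
rewrite /cross_const factS natrM exprS; field.
by apply/andP; split; rewrite ?nat1r pnatr_eq0 -?lt0n ?fact_gt0.
Qed.

Lemma ln_quotient r (m : nat) : 0 < r -> (0 < m)%N -> ln (r / m%:R) = ln r - ln m%:R.
Proof. by move=> r0 m0; rewrite ln_div// posrE ltr0n. Qed.

(** The final 1 is the point 0 in dimension one. Later it adds at most 1 per slice, hence a multiple
    of r, which a larger shift absorbs; 1 <= c ensures that powers of ln r + c are at least 1. *)
Lemma cross_size_le p : exists2 c : R, 1 <= c &
  forall r, 1 <= r ->
    cross_size 0 p.+1 r <= cross_const p * r * (ln r + c) ^+ p + 1.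
Proof.
elim: p => [|p [c c1 ih]].
  exists 1 => // r r1; have r0 : 0 <= r by exact: le_trans r1.
  rewrite cross_size1// r1 /= subn1 /= expr0 mulr1 /cross_const fact0 expr1 divr1.
  have : (Num.truncn r)%:R <= r by rewrite truncn_le.
  by lra.
pose A := cross_const p; have A0 : 0 < A := cross_const_gt0 p.
(* Solves 2 A g = 3 A + 2: the slice m = 0 and the terms m = 1, -1 leave 3 A r X^p, the ones summed
   over m leave 2 r <= 2 r X^p, and increasing the shift by g gains 2 A r X^p g. *)
pose g := 3 / 2 + A^-1; have g0 : 0 < g by rewrite addr_gt0 ?divr_gt0 ?invr_gt0.
exists (c + g); first by rewrite ler_wpDr// ltW.
move=> r r1; have r0 : 0 < r by exact: lt_le_trans r1.
have lr0 : 0 <= ln r by exact: ln_ge0.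
pose X := ln r + c; have X1 : 1 <= X by rewrite ler_wpDl.
have X0 : 0 <= X by exact: le_trans X1.
set N := Num.truncn r.
have N0 : (0 < N)%N by rewrite truncn_gt0.
have Nr : N%:R <= r by rewrite truncn_le ltW.
have lnN : ln N%:R <= X.
  rewrite (@le_trans _ _ (ln r))// ?lerDl ?(le_trans _ c1)//.
  by rewrite ler_ln ?posrE ?ltr0n.
rewrite cross_sizeS /= max0n -/N.
have S1 : \sum_(1 <= m < N.+1) cross_size 0 p.+1 (r / m%:R) <=
    A * r * (X ^+ p + X ^+ p.+1 / p.+1%:R) + r.
  apply: (@le_trans _ _ (\sum_(1 <= m < N.+1) (A * r * ((X - ln m%:R) ^+ p / m%:R) + 1))).
    rewrite big_nat [leRHS]big_nat; apply: ler_sum => m /andP[m0 mN].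
    have mr : 1 <= r / m%:R.
      rewrite ler_pdivlMr ?ltr0n// mul1r; apply: le_trans Nr.
      by rewrite ler_nat.
    apply: le_trans (ih _ mr) _; rewrite ln_quotient// -/A lerD2r.
    rewrite (_ : ln r - ln m%:R + c = X - ln m%:R); last by rewrite /X; ring.
    by rewrite le_eqVlt; apply/orP; left; apply/eqP; ring.
  rewrite big_split /= -mulr_sumr; apply: lerD.
    by rewrite ler_pM2l ?mulr_gt0//; exact: sum_ln_le.
  by rewrite sumr_const_nat subSS subn0.
apply: le_trans (lerD (ih _ r1) (ler_wpM2l _ S1)) _ => //.
rewrite -/A -/X cross_constS -/A addrA -/X.
have Xp1 : 1 <= X ^+ p by exact: exprn_ege1.
have := @subX_ge _ (X + g) X p X0; rewrite lerDl => /(_ (ltW g0)).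
rewrite addrAC subrr add0r => H.
have q0 : 0 < p.+1%:R :> R by rewrite ltr0n.
apply: (@le_trans _ _ (2 * A / p.+1%:R * r * (X ^+ p.+1 + p.+1%:R * X ^+ p * g) + 1)).
  rewrite [X in _ <= X + 1](_ : _ = 2 * A * r * X ^+ p.+1 / p.+1%:R +
      3 * A * r * X ^+ p + 2 * r * X ^+ p).
    rewrite -subr_ge0 [leRHS](_ : _ = 2 * r * (X ^+ p - 1)).
      by rewrite !mulr_ge0 ?subr_ge0// ltW.
    by field; rewrite gt_eqF.
  by rewrite /g; field; rewrite !gt_eqF.
rewrite lerD2r; apply: ler_wpM2l; last by rewrite [leLHS]addrC -lerBrDr.
by rewrite !mulr_ge0 ?invr_ge0 ?ltW.
Qed.

(** The error [E] is only there for [p = 0]: at the next step it is of order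
    [r], and is absorbed by increasing the shift [c]. *)
Lemma cross_size_ge M p : (0 < M)%N -> exists c E : R, [/\ 0 <= c, 0 <= E &
  forall r, 1 <= r ->
    cross_const p * r * Num.max (ln r - c) 0 ^+ p - E <= cross_size M p.+1 r].
Proof.
move=> M0; elim: p => [|p [c [E [c0 E0 ih]]]].
  exists 0, (2 * M%:R); split; rewrite ?mulr_ge0// => r r1.
  have r0 : 0 <= r by exact: le_trans r1.
  rewrite cross_size1// expr0 mulr1 /cross_const fact0 expr1 divr1.
  rewrite (_ : M == 0%N = false) ?add0r; last by apply/negbTE; rewrite -lt0n.
  rewrite (_ : maxn M 1 = M); last by apply/maxn_idPl.
  have := truncnS_gt r; set N := (Num.truncn r).+1 => rN.
  have : N%:R <= (N - M)%:R + M%:R :> R by rewrite -natrD ler_nat; lia.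
  by lra.
pose A := cross_const p; have A0 : 0 < A := cross_const_gt0 p.
pose A' := cross_const p.+1; have A'0 : 0 < A' := cross_const_gt0 p.+1.
(* At most r values of |m| accumulate the error 2 r E, which A' r g covers. The summand 1 gives Y >
   g >= 1 in the nontrivial case, hence (Y - g)^(p+1) <= Y^(p+1) - g. *)
pose g := 1 + 2 * E / A'.
have g1 : 1 <= g by rewrite lerDl divr_ge0 ?(ltW A'0) ?mulr_ge0.
have lM0 : 0 <= ln M%:R :> R by rewrite ln_ge0// (ler_nat R 1).
have g0 : 0 <= g by exact: le_trans g1.
exists (c + ln M%:R + g), 0; split=> [||r r1]; [exact: (addr_ge0 (addr_ge0 c0 lM0) g0)|by []|].
have r0 : 0 < r by exact: lt_le_trans r1.
rewrite subr0 -/A'; pose X := ln r - c; pose Y := X - ln M%:R.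
have -> : ln r - (c + ln M%:R + g) = Y - g by rewrite /Y /X; ring.
have [Yg|gY] := leP Y g.
  by rewrite max_r ?subr_le0// expr0n /= mulr0 cross_size_ge0.
rewrite max_l ?subr_ge0 ?(ltW gY)//.
set N := Num.truncn r.
have Nr : N%:R <= r by rewrite truncn_le ltW.
have rN : r < N.+1%:R by exact: truncnS_gt.
have XN : X <= ln N.+1%:R.
  rewrite (@le_trans _ _ (ln r))// ?gerBl//.
  by rewrite ler_ln ?posrE ?ltr0n// ltW.
have MN : (M <= N.+1)%N.
  rewrite leqNgt; apply/negP => NM.
  have : ln N.+1%:R <= ln M%:R :> R by rewrite ler_ln ?posrE ?ltr0n// ler_nat ltnW.
  by move=> h; move: gY; rewrite ltNge /Y => /negP; apply; lra.
rewrite cross_sizeS -/N (_ : M == 0%N = false) ?add0r; last by apply/negbTE; rewrite -lt0n.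
rewrite (_ : maxn M 1 = M); last by apply/maxn_idPl.
have S1 : A * r * (Y ^+ p.+1 / p.+1%:R) - r * E <=
    \sum_(M <= m < N.+1) cross_size M p.+1 (r / m%:R).
  apply: (@le_trans _ _ (\sum_(M <= m < N.+1)
      (A * r * (Num.max (X - ln m%:R) 0 ^+ p / m%:R) - E))); last first.
    rewrite big_nat [leRHS]big_nat; apply: ler_sum => m /andP[Mm mN].
    have m0 : (0 < m)%N by exact: leq_trans Mm.
    have mr : 1 <= r / m%:R.
      rewrite ler_pdivlMr ?ltr0n// mul1r; apply: le_trans Nr.
      by rewrite ler_nat.
    apply: le_trans (ih _ mr); rewrite ln_quotient// -/A lerD2r.
    rewrite (_ : ln r - ln m%:R - c = X - ln m%:R); last by rewrite /X; ring.
    by rewrite le_eqVlt; apply/orP; left; apply/eqP; ring.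
  rewrite big_split /= -mulr_sumr sumr_const_nat; apply: lerD.
    rewrite ler_pM2l ?mulr_gt0//.
    have := sum_ln_ge p M0 MN XN; rewrite -/Y max_l//.
    by rewrite (le_trans _ (ltW gY))// (le_trans _ g1).
  rewrite mulNrn lerN2 -mulr_natl; apply: ler_wpM2r => //.
  by apply: le_trans Nr; rewrite ler_nat leq_subLR -add1n leq_add2r.
apply: le_trans (ler_wpM2l _ S1) => //.
have q0 : 0 < p.+1%:R :> R by rewrite ltr0n.
have Y0 : 0 <= Y by rewrite (le_trans _ (ltW gY))// (le_trans _ g1).
have Y1 : 1 <= Y by rewrite (le_trans g1)// ltW.
have YY : (Y - g) ^+ p.+1 <= Y ^+ p.+1 - g.
  rewrite exprS; apply: (@le_trans _ _ ((Y - g) * Y ^+ p)).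
    apply: ler_wpM2l; first by rewrite subr_ge0 ltW.
    have Ygle : Y - g <= Y by rewrite gerBl.
    have Yg0 : 0 <= Y - g by rewrite subr_ge0 ltW.
    by apply: lerXn2r; rewrite ?nnegrE.
  rewrite mulrBl exprS lerD2l lerN2 ler_peMr//.
  exact: exprn_ege1.
apply: (@le_trans _ _ (A' * r * (Y ^+ p.+1 - g))).
  by apply: ler_wpM2l => //; rewrite mulr_ge0 ?ltW.
rewrite -subr_ge0.
rewrite [leRHS](_ : _ = A' * r * (g - 2 * E / A')); last first.
  have AE : 2 * A / p.+1%:R = A' by rewrite /A' cross_constS.
  rewrite (_ : 2 * (_ - _) = 2 * A / p.+1%:R * r * Y ^+ p.+1 - 2 * r * E).
    by rewrite AE; field; rewrite gt_eqF.
  by field; rewrite nat1r gt_eqF.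
by rewrite /g addrK mulr1 mulr_ge0 ?ltW.
Qed.
End CrossSizeAsymptotics.

(** * Asymptotics *)

Section WeightBounds.
Variables (R : realType) (d : nat) (s : R).
Hypothesis s_gt0 : 0 < s.
Local Notation a_ := (approx_number (@Hmix_norm R d s) (@L2norm _ _ R (torus_measure R d))
  (Hmix_embedding d s)).
Implicit Types (k : d.-tuple int) (r : R).

Lemma prod_powR (I : Type) (l : seq I) (F : I -> R) (a : R) : (forall i, 0 <= F i) ->
  \prod_(i <- l) (F i `^ a) = (\prod_(i <- l) F i) `^ a.
Proof.
move=> F0; elim: l => [|i l ih]; first by rewrite !big_nil powR1.
by rewrite !big_cons ih powRM// prodr_ge0.
Qed.

Lemma absz_intr (m : int) : `|m|%:~R = (`|m|%N)%:R :> R.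
Proof. by rewrite -abszE. Qed.

Lemma mix_weight_ge k : (\prod_(j < d) absz1 (tnth k j)) `^ (2 * s) <= mix_weight s k :> R.
Proof.
rewrite -prod_powR; last by move=> j; exact/ltW/absz1_gt0.
apply: ler_prod => j _; rewrite powR_ge0 /= absz_intr /absz1.
have [->|m0] := eqVneq `|tnth k j|%N 0%N; first by rewrite maxn0 powR1 lerDl powR_ge0.
by rewrite (maxn_idPr _) ?lt0n// lerDr.
Qed.

(** The condition on [M] reads 1 <= (t^-1 - 1) M^(2s), so every |k_j| >= M inherits it, at a cost of
    t^-1 per coordinate. *)
Lemma mix_weight_le (M : nat) (t : R) k : (0 < M)%N -> 0 < t ->
  1 + M%:R `^ (2 * s) <= t^-1 * M%:R `^ (2 * s) -> (forall j, (M <= `|tnth k j|)%N) ->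
  mix_weight s k <= t^-1 ^+ d * (\prod_(j < d) absz1 (tnth k j)) `^ (2 * s).
Proof.
move=> M0 t0 Mt kM; rewrite -prod_powR; last by move=> j; exact/ltW/absz1_gt0.
rewrite -[d in _ ^+ d]card_ord -prodr_const -big_split /=.
apply: ler_prod => j _; rewrite addr_ge0 ?powR_ge0 //= absz_intr /absz1.
have kj0 : (0 < `|tnth k j|)%N by exact: leq_trans (kM j).
rewrite (maxn_idPr _)//.
have : M%:R `^ (2 * s) <= (`|tnth k j|%N)%:R `^ (2 * s) :> R.
  by rewrite ge0_ler_powR ?nnegrE ?mulr_ge0 ?(ltW s_gt0)// ler_nat.
have M2 : 0 < M%:R `^ (2 * s) :> R by apply: powR_gt0; rewrite ltr0n.
move: Mt M2; move: (M%:R `^ _) (`|tnth k j|%N%:R `^ _) => x y; rewrite -subr_ge0 => H x0 xy.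
have t1 : 0 < t^-1 - 1.
  rewrite -(pmulr_lgt0 _ x0); lra.
have : (t^-1 - 1) * x <= (t^-1 - 1) * y by rewrite ler_pM2l.
by lra.
Qed.

Lemma invr_sqrt_powR r (c : R) : 0 < r -> 0 <= c ->
  (Num.sqrt (c * r `^ (2 * s)))^-1 = (Num.sqrt c)^-1 * r `^ (- s).
Proof.
move=> r0 c0; rewrite sqrtrM// invfM powRN; congr (_ * _^-1).
by rewrite mulrC powRrM powR_mulrn ?powR_ge0// sqrtr_sqr ger0_norm// powR_ge0.
Qed.

Lemma approx_number_le_powR n r : 1 <= r -> cross_size 0 d r < n%:R -> a_ n <= r `^ (- s).
Proof.
move=> r1; have r0 : 0 < r by exact: lt_le_trans r1.
rewrite ltr_nat => sn; rewrite -[leRHS]mul1r -[X in X * _]invr1 -sqrtr1.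
rewrite -invr_sqrt_powR// mul1r.
apply: approx_number_le sn _ _; [exact: uniq_hyperbolic_cross|exact: powR_gt0|].
move=> k; rewrite mem_hyperbolic_cross negb_and => /orP[/forallPn[j]//|].
rewrite -ltNge => rk; apply: le_trans (mix_weight_ge k).
by rewrite ge0_ler_powR ?nnegrE ?mulr_ge0 ?(ltW s_gt0) ?(ltW r0) ?(ltW rk)// (le_trans (ltW r0)) ?ltW.
Qed.

Lemma approx_number_ge_powR (M n : nat) (t r : R) : (0 < M)%N -> (0 < n)%N -> 0 < t -> 0 < r ->
  1 + M%:R `^ (2 * s) <= t^-1 * M%:R `^ (2 * s) -> n%:R <= cross_size M d r ->
  t `^ (d%:R / 2) * r `^ (- s) <= a_ n.
Proof.
move=> M0 n0 t0 r0 Mt; rewrite ler_nat => ns.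
have td0 : 0 < t^-1 ^+ d by rewrite exprn_gt0// invr_gt0.
have -> : t `^ (d%:R / 2) = (Num.sqrt (t^-1 ^+ d))^-1.
  have E : (t `^ (d%:R / 2)) ^+ 2 = t ^+ d.
    by rewrite -powR_mulrn ?powR_ge0// -powRrM divfK// powR_mulrn// ltW.
  by rewrite exprVn -E -exprVn sqrtr_sqr ger0_norm ?invrK// invr_ge0 powR_ge0.
rewrite -invr_sqrt_powR//; last exact: ltW.
apply: (@approx_number_ge _ _ _ (hyperbolic_cross M d r)).
- exact: uniq_hyperbolic_cross.
- by rewrite n0.
- by rewrite mulr_gt0// powR_gt0.
move=> k; rewrite mem_hyperbolic_cross => /andP[/forallP kM kr].
apply: le_trans (mix_weight_le M0 t0 Mt kM) _.
rewrite ler_pM2l//; apply: ge0_ler_powR; rewrite ?nnegrE ?mulr_ge0 ?(ltW s_gt0) ?(ltW r0)//.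
by rewrite (le_trans _ (prod_absz1_ge1 k)).
Qed.
End WeightBounds.

(** * Comparison of y - p ln y with multiples of y *)

Section Growth.
Variable R : realType.

Lemma near_ln_ge (K : R) : \forall n \near \oo, K <= ln n%:R.
Proof.
near=> n; have Kn : expR K <= n%:R by near: n; exact: nbhs_infty_ger.
have n0 : 0 < n%:R :> R by rewrite (lt_le_trans _ Kn)// expR_gt0.
by rewrite -[K]expRK ler_ln ?posrE ?expR_gt0.
Unshelve. all: by end_near. Qed.

(** For y = ln n, the right-hand side is the logarithm of [cross_radius] up to a shift. The bound
    ln(h y) <= h y - 1 with small slope [h] makes ln y negligible against y. *)
Lemma sub_ln_ge (p : nat) (b u : R) : u < 1 ->
  exists2 K : R, 0 < K & forall y, K <= y -> u * y <= y - p%:R * ln y + b.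
Proof.
(* Half of the gap 1 - u pays for p h y, the other half for the constant [B']; dividing by p + 1
   covers p = 0. *)
move=> u1; pose h : R := (1 - u) / (2 * p.+1%:R).
have p0 : 0 < p.+1%:R :> R by rewrite ltr0n.
have h0 : 0 < h by rewrite divr_gt0 ?mulr_gt0 ?subr_gt0.
pose B' : R := - p%:R * ln h - b.
exists (1 + `|B'| / ((1 - u) / 2)) => [|y Ky].
  by rewrite ltr_pwDl// divr_ge0// divr_ge0// subr_ge0 ltW.
have u2 : 0 < (1 - u) / 2 by rewrite divr_gt0 ?subr_gt0.
have y0 : 0 < y.
  by apply: lt_le_trans Ky; rewrite ltr_pwDl// divr_ge0// ltW.
have lny : ln y <= h * y - ln h.
  have hy0 : 0 < h * y by rewrite mulr_gt0.
  have := @le_ln1Dx _ (h * y - 1).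
  rewrite ltrBrDr addNr => /(_ hy0).
  by rewrite [1 + _]addrC subrK lnM ?posrE//; lra.
have yB : B' <= (1 - u) / 2 * y.
  apply: (le_trans (ler_norm _)); rewrite -ler_pdivrMl// mulrC.
  by apply: le_trans Ky; rewrite lerDr.
have ph : p%:R * h * y <= (1 - u) / 2 * y.
  rewrite ler_pM2r// /h mulrCA ler_pM2l ?subr_gt0// invfM mulrCA.
  rewrite ger_pMr ?invr_gt0// ler_pdivrMr// mul1r ler_nat//.
have : p%:R * ln y <= p%:R * (h * y - ln h) by rewrite ler_wpM2l.
by move: yB ph; rewrite /B'; lra.
Qed.

Lemma sub_ln_le (p : nat) (b u : R) : 1 < u ->
  exists2 K : R, 0 < K & forall y, K <= y -> y - p%:R * ln y + b <= u * y.
Proof.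
move=> u1; have u0 : 0 < u - 1 by rewrite subr_gt0.
exists (1 + `|b| / (u - 1)) => [|y Ky].
  by rewrite ltr_pwDl// divr_ge0// ltW.
have y1 : 1 <= y by apply: le_trans Ky; rewrite lerDl divr_ge0// ltW.
have pl : 0 <= p%:R * ln y by rewrite mulr_ge0// ln_ge0.
have : b <= (u - 1) * y.
  apply: (le_trans (ler_norm _)); rewrite -ler_pdivrMl// mulrC.
  by apply: le_trans Ky; rewrite lerDr.
by lra.
Qed.
End Growth.

(** * Passage to the limit *)

Section MainLimit.
Variables (R : realType) (p : nat) (s : R).
Hypothesis s_gt0 : 0 < s.
Local Notation a_ := (approx_number (@Hmix_norm R p.+1 s)
  (@L2norm _ _ R (torus_measure R p.+1)) (Hmix_embedding p.+1 s)).
Local Notation C := (@cross_const R p).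

Definition normalized_approx (n : nat) : R :=
  n%:R `^ s * a_ n / (ln n%:R) `^ (p%:R * s).

(** The hyperbolic cross of this radius has about [t^-(p+1) n] elements. *)
Definition cross_radius (t : R) (n : nat) : R :=
  t^-1 ^+ p.+1 * n%:R / (C * ln n%:R ^+ p).

Lemma ln_cross_radius (t : R) n : 0 < t -> (0 < n)%N -> 0 < ln n%:R :> R ->
  0 < cross_radius t n /\
  ln (cross_radius t n) = ln n%:R - p%:R * ln (ln n%:R) + (ln (t^-1 ^+ p.+1) - ln C).
Proof.
move=> t0 n0 y0; have C0 := @cross_const_gt0 R p.
have n0R : 0 < n%:R :> R by rewrite ltr0n.
have tp : 0 < t^-1 ^+ p.+1 by rewrite exprn_gt0// invr_gt0.
have yp : 0 < ln n%:R ^+ p :> R by rewrite exprn_gt0.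
rewrite /cross_radius; split; first by rewrite divr_gt0 ?mulr_gt0.
rewrite ln_div ?posrE ?mulr_gt0// !lnM ?posrE// lnXn// -mulr_natl.
ring.
Qed.

(** An exact identity: with this radius all dependence on [n] cancels, and only a power of [t]
    remains to be sent to 1. *)
Lemma normalized_powR (t : R) n : 0 < t -> (0 < n)%N -> 0 < ln n%:R :> R ->
  n%:R `^ s * cross_radius t n `^ (- s) / (ln n%:R) `^ (p%:R * s) =
  C `^ s * t `^ (p.+1%:R * s).
Proof.
move=> t0 n0 y0; have [r0 _] := ln_cross_radius t0 n0 y0.
have n0R : 0 < n%:R :> R by rewrite ltr0n.
have C0 := @cross_const_gt0 R p.
have yp : 0 < ln n%:R ^+ p :> R by rewrite exprn_gt0.
rewrite !powRrM !powR_mulrn ?(ltW t0) ?(ltW y0)// powRN -powRM ?exprn_ge0 ?(ltW t0) ?(ltW C0)//.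
have {1}-> : n%:R = C * t ^+ p.+1 * (cross_radius t n * ln n%:R ^+ p).
  rewrite /cross_radius exprVn; field.
  by rewrite !gt_eqF ?exprn_gt0.
have Ct0 : 0 < C * t ^+ p.+1 by rewrite mulr_gt0 ?exprn_gt0.
have rY0 := mulr_ge0 (ltW r0) (ltW yp).
rewrite [X in X / _ / _](powRM _ (ltW Ct0) rY0).
rewrite [X in _ * X / _ / _](powRM _ (ltW r0) (ltW yp)); field.
by rewrite !gt_eqF ?powR_gt0.
Qed.

Lemma normalized_approx_le (t : R) : 1 < t ->
  \forall n \near \oo, normalized_approx n <= C `^ s * t `^ (p.+1%:R * s).
Proof.
move=> t1; have t0 : 0 < t by exact: lt_trans t1.
have [c c1 Hc] := @cross_size_le R p.
have [K K0 HK] := sub_ln_le p (ln (t^-1 ^+ p.+1) - ln C + c) t1.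
(* The case u = 0 yields ln r >= 0, that is 1 <= r, as the counting bound requires. *)
have [K' K'0 HK'] := sub_ln_ge p (ln (t^-1 ^+ p.+1) - ln C) (ltr01 : 0 < 1 :> R).
near=> n.
have yK : K <= ln n%:R by near: n; exact: near_ln_ge.
have yK' : K' <= ln n%:R by near: n; exact: near_ln_ge.
(* Equivalent to n/t + 1 < n, where n/t is what C r (t ln n)^p amounts to and 1 is the additive term
   of the count. *)
have nt : t / (t - 1) < n%:R.
  rewrite (@lt_le_trans _ _ (t / (t - 1) + 1))// ?ltrDl//.
  by near: n; exact: nbhs_infty_ger.
pose y : R := ln n%:R; have y0 : 0 < y by exact: lt_le_trans yK.
have n0 : (0 < n)%N.
  by rewrite -(ltr0n R); apply: lt_trans nt; rewrite divr_gt0// subr_gt0.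
have [r0 lr] := ln_cross_radius t0 n0 y0.
set r := cross_radius t n in r0 lr *.
have lr0 : 0 <= ln r by rewrite lr; have := HK' _ yK'; rewrite mul0r.
have r1 : 1 <= r by rewrite -[r]lnK ?posrE// -expR0 ler_expR.
have lrc : ln r + c <= t * y by rewrite lr -addrA; exact: HK.
have yp : 0 < y ^+ p by rewrite exprn_gt0.
have C0 := @cross_const_gt0 R p.
have n0R : 0 < n%:R :> R by rewrite ltr0n.
have sz : cross_size 0 p.+1 r < n%:R.
  apply: le_lt_trans (Hc _ r1) _.
  apply: (@le_lt_trans _ _ (C * r * (t * y) ^+ p + 1)).
    rewrite lerD2r; apply: ler_wpM2l; first by rewrite mulr_ge0// ltW.
    apply: lerXn2r; rewrite ?nnegrE ?addr_ge0 ?(le_trans _ c1)//.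
    by rewrite mulr_ge0// ltW.
  have -> : C * r * (t * y) ^+ p = n%:R / t.
    rewrite /r /cross_radius -/y exprMn exprVn exprS; field.
    by rewrite !gt_eqF ?exprn_gt0.
  move: nt; rewrite ltr_pdivrMr ?subr_gt0// => nt.
  rewrite -ltrBrDr ltr_pdivrMr//; lra.
rewrite /normalized_approx -/y -(normalized_powR t0 n0 y0) -/r -/y.
apply: ler_wpM2r; first by rewrite invr_ge0 powR_ge0.
apply: ler_wpM2l; first exact: powR_ge0.
exact: approx_number_le_powR.
Unshelve. all: by end_near. Qed.

Lemma exists_cutoff (t : R) : 0 < t -> t < 1 ->
  exists2 M : nat, (0 < M)%N & 1 + M%:R `^ (2 * s) <= t^-1 * M%:R `^ (2 * s).
Proof.
move=> t0 t1; have e0 : 0 < t^-1 - 1 by rewrite subr_gt0 invf_gt1.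
have s2 : 2 * s != 0 by rewrite mulf_neq0// gt_eqF.
(* Solves (t^-1 - 1) x^(2s) = 1. *)
pose x := (t^-1 - 1)^-1 `^ (2 * s)^-1; exists (Num.truncn x).+1 => //.
have : x `^ (2 * s) <= (Num.truncn x).+1%:R `^ (2 * s).
  rewrite ge0_ler_powR ?nnegrE ?powR_ge0 ?mulr_ge0 ?(ltW s_gt0)//.
  exact/ltW/truncnS_gt.
rewrite /x -powRrM mulVf// powRr1 ?invr_ge0 ?(ltW e0)// -/x.
move: (_ `^ (2 * s)) => z; rewrite -[_^-1]mul1r ler_pdivrMr//; lra.
Qed.

Lemma normalized_approx_ge (t : R) : 0 < t -> t < 1 ->
  \forall n \near \oo, t `^ (p.+1%:R / 2) * (C `^ s * t `^ (p.+1%:R * s)) <= normalized_approx n.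
Proof.
move=> t0 t1; have [M M0 Mt] := exists_cutoff t0 t1.
have [c [E [c0 E0 Hc]]] := @cross_size_ge R M p M0.
have [K K0 HK] := sub_ln_ge p (ln (t^-1 ^+ p.+1) - ln C - c) t1.
near=> n.
have yK : K <= ln n%:R by near: n; exact: near_ln_ge.
(* The fraction is at most n exactly when n <= n/t - E; the extra 1 makes n positive. *)
have nE : E * t / (1 - t) + 1 <= n%:R by near: n; exact: nbhs_infty_ger.
pose y : R := ln n%:R; have y0 : 0 < y by exact: lt_le_trans yK.
have t10 : 0 < 1 - t by rewrite subr_gt0.
have n0 : (0 < n)%N.
  rewrite -(ltr0n R); apply: lt_le_trans nE; rewrite ltr_wpDl//.
  by rewrite divr_ge0 ?mulr_ge0 ?(ltW t0) ?(ltW t10).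
have [r0 lr] := ln_cross_radius t0 n0 y0.
set r := cross_radius t n in r0 lr *.
have lrc : t * y <= ln r - c by rewrite lr -addrA; exact: HK.
have ty0 : 0 <= t * y by rewrite mulr_ge0// ltW.
have lrc0 : 0 <= ln r - c by exact: le_trans lrc.
have r1 : 1 <= r.
  by rewrite -[r]lnK ?posrE// -expR0 ler_expR (le_trans lrc0)// gerBl.
have yp : 0 < y ^+ p by rewrite exprn_gt0.
have C0 := @cross_const_gt0 R p.
have n0R : 0 < n%:R :> R by rewrite ltr0n.
have sz : n%:R <= cross_size M p.+1 r.
  apply: le_trans (Hc _ r1); rewrite max_l//.
  apply: (@le_trans _ _ (C * r * (t * y) ^+ p - E)); last first.
    rewrite lerD2r; apply: ler_wpM2l; first by rewrite mulr_ge0// ltW.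
    by apply: lerXn2r; rewrite ?nnegrE.
  have -> : C * r * (t * y) ^+ p = n%:R / t.
    rewrite /r /cross_radius -/y exprMn exprVn exprS; field.
    by rewrite !gt_eqF ?exprn_gt0.
  have : E * t / (1 - t) <= n%:R by apply: le_trans nE; rewrite lerDl.
  rewrite ler_pdivrMr// => nE'.
  by rewrite lerBrDr ler_pdivlMr//; lra.
rewrite /normalized_approx -/y -(normalized_powR t0 n0 y0) -/r -/y.
rewrite mulrA; apply: ler_wpM2r; first by rewrite invr_ge0 powR_ge0.
rewrite mulrCA; apply: ler_wpM2l; first exact: powR_ge0.
exact: (approx_number_ge_powR s_gt0 M0).
Unshelve. all: by end_near. Qed.

Lemma cvg_normalized_approx : normalized_approx @ \oo --> C `^ s.
Proof.
have L0 : 0 < C `^ s by exact/powR_gt0/cross_const_gt0.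
apply/cvgrPdist_le => e e0.
pose q : R := e / C `^ s; have q0 : 0 < q by rewrite divr_gt0.
have q1 : 1 < 1 + q by rewrite ltrDl.
have l0 : 0 < ln (1 + q) by exact: ln_gt0.
have d0 : 0 < p.+1%:R :> R by rewrite ltr0n.
have ds0 : 0 < p.+1%:R * s by rewrite mulr_gt0.
(* [t1] and [t2] are chosen so that the excess factors of the two bounds are exactly 1 + q and (1 +
   q)^-1; the exponent [k] adds the loss from the weights to the one from the radius. *)
pose t1 := expR (ln (1 + q) / (p.+1%:R * s)).
have t11 : 1 < t1 by rewrite expR_gt1 divr_gt0.
have t1E : t1 `^ (p.+1%:R * s) = 1 + q.
  by rewrite -expRM divfK ?gt_eqF// lnK// posrE (lt_trans _ q1).
pose k := p.+1%:R / 2 + p.+1%:R * s.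
have k0 : 0 < k by rewrite addr_gt0// divr_gt0.
pose t2 := expR (- ln (1 + q) / k).
have t20 : 0 < t2 by exact: expR_gt0.
have t21 : t2 < 1 by rewrite -expR0 ltr_expR mulNr oppr_lt0 divr_gt0.
have t2E : t2 `^ (p.+1%:R / 2) * t2 `^ (p.+1%:R * s) = (1 + q)^-1.
  rewrite -powRD ?gt_eqF ?implybT// -/k -expRM divfK ?gt_eqF// expRN.
  by rewrite lnK// posrE (lt_trans _ q1).
have eE : e = q * C `^ s by rewrite /q divfK// gt_eqF.
have q1V : 1 - q <= (1 + q)^-1.
  rewrite -[leRHS]mul1r ler_pdivlMr ?(lt_trans _ q1)//.
  by rewrite -subr_ge0 [leRHS](_ : _ = q ^+ 2) ?sqr_ge0//; ring.
near=> n.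
have : normalized_approx n <= C `^ s * (1 + q).
  by rewrite -t1E; near: n; exact: normalized_approx_le.
have : C `^ s * (1 + q)^-1 <= normalized_approx n.
  rewrite -t2E mulrCA; near: n; exact: normalized_approx_ge.
move: (normalized_approx n) => x h1 h2.
have {q1V}h1 : C `^ s * (1 - q) <= x by apply: le_trans h1; rewrite ler_pM2l.
rewrite ler_distlC eE [q * _]mulrC.
by move: h1 h2; rewrite mulrBr mulrDr mulr1 => -> ->.
Unshelve. all: by end_near. Qed.
End MainLimit.

Theorem corollary4p17 (R : realType) (d : nat) (s : R)
    (d_gt0 : (0 < d)%N) (s_gt0 : 0 < s) :
  (n%:R `^ s
     * approx_number (@Hmix_norm R d s) (@L2norm _ _ R (torus_measure R d))
         (Hmix_embedding d s) n
     / (ln n%:R) `^ ((d.-1)%:R * s)) @[n --> \oo]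
  --> (2 ^+ d / ((d.-1)`!)%:R) `^ s.
Proof. by case: d d_gt0 => // p _; exact: cvg_normalized_approx. Qed.
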